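(* Let $H$ be a real or complex infinite dimensional separable Hilbert space. Let $X,Y\subset H$ be finite dimensional linear subspaces and let $(V,W)\in\mathrm{Fp}(H)$ be a Fredholm pair such that $X\cap Y=(0)$ and $(X+Y)\cap V=(0)$. Then \[ S(X,(Y+V,W))\circ\big(\mathrm{id}_{\mathrm{Det}(X)}\otimes S(Y,(V,W))\big)=S(X+Y,(V,W))\circ\big(S(X,Y)\otimes\mathrm{id}_{\mathrm{Det}(V,W)}\big) \] as maps $\mathrm{Det}(X)\otimes\mathrm{Det}(Y)\otimes\mathrm{Det}(V,W)\to\mathrm{Det}(X+Y+V,W)$.
   Context: $\mathrm{Fp}(H)$ is the set of Fredholm pairs, i.e. pairs $(V,W)$ of closed subspaces of $H$ with $\dim (V\cap W)<\infty$ and $\mathrm{codim}(V+W)<\infty$. $\mathrm{Det}(X)=\Lambda_{\max}(X)$ is the top exterior power of a finite dimensional space $X$; $\xi^*$ is the dual generator of a generator $\xi$ of a line. $\mathrm{Det}(V,W):=\mathrm{Det}(V\cap W)\otimes\mathrm{Det}(H/(V+W))^*$ for a Fredholm pair. For finite dimensional $X,Y$ with $X\cap Y=(0)$, $S(X,Y):\mathrm{Det}(X)\otimes\mathrm{Det}(Y)\to\mathrm{Det}(X+Y)$ is $\xi\otimes\eta\mapsto\xi\wedge\eta$. For $X$ finite dimensional and $(V,W)\in\mathrm{Fp}(H)$ with $X\cap V=(0)$, the isomorphism $S(X,(V,W)):\mathrm{Det}(X)\otimes\mathrm{Det}(V,W)\to\mathrm{Det}(X+V,W)$ is defined as follows.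 Consider the exact sequence \[ 0\to V\cap W\xrightarrow{T_1}(X+V)\cap W\xrightarrow{T_2}X\xrightarrow{T_3}\frac{H}{V+W}\xrightarrow{T_4}\frac{H}{X+V+W}\to0, \] where $T_1$ is the inclusion, $T_2(x+v)=x$ for $x\in X$, $v\in V$ (i.e. the projection to $(X+V)/V\cong X$), and $T_3,T_4$ are induced by quotient projections. Let $d_1,\dots,d_5$ be the dimensions of its five terms. Choose homogeneous elements $\alpha_1,\dots,\alpha_4$ of the exterior algebras of the first four terms such that $\alpha_1$, $T_{1*}\alpha_1\wedge\alpha_2$, $T_{2*}\alpha_2\wedge\alpha_3$, $T_{3*}\alpha_3\wedge\alpha_4$, $T_{4*}\alpha_4$ generate the determinants of the five terms, respectively. Then \[ S(X,(V,W))\big((T_{2*}\alpha_2\wedge\alpha_3)\otimes\alpha_1\otimes(T_{3*}\alpha_3\wedge\alpha_4)^*\big)=(-1)^{d_3d_1+d_5(d_4-d_5)}\,(T_{1*}\alpha_1\wedge\alpha_2)\otimes(T_{4*}\alpha_4)^*, \] which is independent of the choices. *)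

(* Defs.v *)
From HB Require Import structures.
From mathcomp Require Import all_boot all_order all_algebra.
From mathcomp Require Import complex sesquilinear finmap.
From mathcomp Require Import all_classical all_reals all_analysis.

Set Implicit Arguments.
Unset Strict Implicit.
Unset Printing Implicit Defensive.

Import Order.TTheory GRing.Theory Num.Theory numFieldNormedType.Exports.

Local Open Scope classical_set_scope.
Local Open Scope quotient_scope.
Local Open Scope ring_scope.

Reserved Notation "x ⊗ y" (at level 40, left associativity).
Reserved Notation "x ∧ y" (at level 40, left associativity).

(* Several linear maps below are introduced by their values on generators, as
   [get P], which satisfies [P] as soon as some linear map does (and is the zero
   map otherwise). *)

Section Subspaces.
Variables (K : fieldType) (M : lmodType K).

Record lsubspace := LSubspace {
  lsubspace_set :> set M;
  lsubspace_closed : lsubspace_set 0 /\ forall a u v,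
    lsubspace_set u -> lsubspace_set v -> lsubspace_set (a *: u + v) }.

Lemma lsubspace_eq (V W : lsubspace) : V = W :> set M -> V = W.
Proof.
by case: V W => [V hV] [W hW] /= e; case: _ / e hW => hW; congr LSubspace.
Qed.

Definition lsubspace_pred (V : lsubspace) : {pred M} :=
  fun v => v \in (V : set M).
Canonical lsubspace_predType := PredType lsubspace_pred.

Lemma lsubspace_submod V : submod_closed (lsubspace_pred V).
Proof.
have [V0 VD] := lsubspace_closed V.
split=> [|a u v]; first exact: mem_set.
by move=> /set_mem Vu /set_mem Vv; apply: mem_set; exact: VD.
Qed.
HB.instance Definition _ V :=
  GRing.isSubmodClosed.Build K M (lsubspace_pred V)
    (GRing.submod_closed_semi (lsubspace_submod V)).

Record lsub_of (V : lsubspace) :=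
  LSub { lsub_val :> M; _ : lsub_val \in lsubspace_pred V }.

HB.instance Definition _ V := [isSub of lsub_of V for @lsub_val V].
HB.instance Definition _ V := [Choice of lsub_of V by <:].
HB.instance Definition _ V := [SubChoice_isSubZmodule of lsub_of V by <:].
HB.instance Definition _ V := [SubZmodule_isSubLmodule of lsub_of V by <:].

Lemma lsub_val_linear V : linear (@lsub_val V). Proof. by []. Qed.
HB.instance Definition _ V := GRing.isSemilinear.Build K (lsub_of V) M _
  (@lsub_val V) (GRing.semilinear_linear (@lsub_val_linear V)).

Lemma capS_closed (V W : lsubspace) : let S := V `&` W in
  S 0 /\ forall a u v, S u -> S v -> S (a *: u + v).
Proof.
have [V0 VD] := lsubspace_closed V; have [W0 WD] := lsubspace_closed W.
by split=> [//|a u v [Vu Wu] [Vv Wv]]; split; [exact: VD|exact: WD].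
Qed.
Definition capS V W := LSubspace (capS_closed V W).

Lemma addS_closed (V W : lsubspace) : let S := [set v + w | v in V & w in W] in
  S 0 /\ forall a u v, S u -> S v -> S (a *: u + v).
Proof.
have [V0 VD] := lsubspace_closed V; have [W0 WD] := lsubspace_closed W.
split=> [|a _ _ [v Vv [w Ww <-]] [v' Vv' [w' Ww' <-]]].
  by exists 0 => //; exists 0 => //; rewrite addr0.
exists (a *: v + v'); first exact: VD.
by exists (a *: w + w'); [exact: WD|rewrite scalerDr addrACA].
Qed.
Definition addS V W := LSubspace (addS_closed V W).

Lemma addSA (U V W : lsubspace) : addS U (addS V W) = addS (addS U V) W.
Proof.
apply/lsubspace_eq/seteqP; split=> x /=.
  move=> [u Uu [_ [v Vv [w Ww <-]] <-]]; exists (u + v).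
    by exists u => //; exists v.
  by exists w => //; rewrite addrA.
move=> [_ [u Uu [v Vv <-]] [w Ww <-]]; exists u => //.
by exists (v + w); [exists v => //; exists w|rewrite addrA].
Qed.

Lemma span_closed (A : set M) :
  let S := [set v | forall V : lsubspace, A `<=` V -> v \in V] in
  S 0 /\ forall a u v, S u -> S v -> S (a *: u + v).
Proof.
split=> [V _|a u v Su Sv V AV]; first exact: (rpred0 (lsubspace_pred V)).
by apply: (@rpredD _ (lsubspace_pred V)); [apply: rpredZ; exact: Su|exact: Sv].
Qed.
Definition spanS (A : set M) := LSubspace (span_closed A).

Lemma sub_spanS (A : set M) : A `<=` spanS A.
Proof. by move=> x Ax V AV; apply: mem_set; exact: AV. Qed.

(* The inclusion of [V] into [W], for [V] contained in [W]. *)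
Definition lincl (V W : lsubspace) : {linear lsub_of V -> lsub_of W} :=
  get [set f : {linear lsub_of V -> lsub_of W} |
        forall v, f v = v :> M].

End Subspaces.

Section Quotients.
Variables (K : fieldType) (M : lmodType K) (N : lsubspace M).

Definition lquot := Quotient.quot (lsubspace_pred N : zmodClosed M).
HB.instance Definition _ := GRing.Zmodule.on lquot.
HB.instance Definition _ : EqQuotient M _ lquot := EqQuotient.on lquot.

Definition lproj_fun (x : M) : lquot := \pi x.

Lemma lproj_eqE x y : (lproj_fun x == lproj_fun y) = (x - y \in lsubspace_pred N).
Proof. by rewrite Quotient.idealrBE. Qed.

Lemma lprojD x y : lproj_fun (x + y) = lproj_fun x + lproj_fun y.
Proof. by rewrite /lproj_fun; apply: (raddfD (\pi_(Quotient.quot _))). Qed.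

Definition lquot_scale (a : K) (q : lquot) : lquot := lproj_fun (a *: repr q).

Lemma lquot_scaleE a x : lquot_scale a (lproj_fun x) = lproj_fun (a *: x).
Proof.
apply/eqP; rewrite lproj_eqE -scalerBr; apply: rpredZ.
by rewrite -lproj_eqE; apply/eqP; exact: (reprK (lproj_fun x : lquot)).
Qed.

Lemma lproj_surj (q : lquot) : exists x, q = lproj_fun x.
Proof. by exists (repr q); rewrite /lproj_fun reprK. Qed.

Lemma lquot_scaleA a b q : lquot_scale a (lquot_scale b q) = lquot_scale (a * b) q.
Proof. by have [x ->] := lproj_surj q; rewrite !lquot_scaleE scalerA. Qed.
Lemma lquot_scale1 : left_id 1 lquot_scale.
Proof. by move=> q; have [x ->] := lproj_surj q; rewrite lquot_scaleE scale1r. Qed.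
Lemma lquot_scaleDr : right_distributive lquot_scale +%R.
Proof.
move=> a q r; have [x ->] := lproj_surj q; have [y ->] := lproj_surj r.
by rewrite -lprojD !lquot_scaleE scalerDr lprojD.
Qed.
Lemma lquot_scaleDl q : {morph lquot_scale^~ q : a b / a + b}.
Proof.
move=> a b; have [x ->] := lproj_surj q.
by rewrite !lquot_scaleE scalerDl lprojD.
Qed.
HB.instance Definition _ := GRing.Zmodule_isLmodule.Build K lquot
  lquot_scaleA lquot_scale1 lquot_scaleDr lquot_scaleDl.

Lemma lproj_linear : linear lproj_fun.
Proof. by move=> a x y; rewrite lprojD -lquot_scaleE. Qed.
HB.instance Definition _ := GRing.isLinear.Build K M lquot _ lproj_fun lproj_linear.
Definition lproj : {linear M -> lquot} := lproj_fun.

End Quotients.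

Section Universal.
Variables (K : fieldType).
Implicit Types M P : lmodType K.

Lemma mk_linear M P (f : M -> P) : linear f ->
  exists g : {linear M -> P}, g =1 f.
Proof.
move=> lf.
pose g : {linear M -> P} := HB.pack f (GRing.isLinear.Build K M P _ f lf).
by exists g.
Qed.

Lemma spanS_ker M P (f : {linear M -> P}) (A : set M) :
  (forall x, A x -> f x = 0) -> forall x, x \in spanS A -> f x = 0.
Proof.
move=> fA x /set_mem.
have kerP : let S := [set x | f x = 0] in
    S 0 /\ forall a u v, S u -> S v -> S (a *: u + v).
  by split=> /= [|a u v fu fv]; rewrite ?linear0// linearP fu fv scaler0 addr0.
by move=> /(_ (LSubspace kerP) fA)/set_mem.
Qed.

Lemma lquot_univ M P (N : lsubspace M) (f : {linear M -> P}) :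
  (forall x, x \in N -> f x = 0) ->
  exists g : {linear lquot N -> P}, forall x, g (lproj N x) = f x.
Proof.
move=> fN; have fE x : f (repr (lproj N x)) = f x.
  apply/eqP; rewrite -subr_eq0 -linearB fN// -[_ \in _]lproj_eqE.
  by apply/eqP; exact: (reprK (lproj N x : lquot N)).
have /mk_linear[g gE] : linear (fun q : lquot N => f (repr q)).
  move=> a q r; have [x ->] := lproj_surj q; have [y ->] := lproj_surj r.
  by rewrite -[lproj_fun _ x]/(lproj N x) -[lproj_fun _ y]/(lproj N y) -linearP
    !fE linearP.
by exists g => x; rewrite gE fE.
Qed.

Lemma lquot_ext M P (N : lsubspace M) (f g : {linear lquot N -> P}) :
  (forall x, f (lproj N x) = g (lproj N x)) -> f =1 g.
Proof. by move=> fg q; have [x ->] := lproj_surj q; exact: fg. Qed.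

End Universal.

Section FreeModules.
Variables (K : fieldType) (S : choiceType).

Lemma finsupp_closed :
  let F := [set f : S -> K^o | finite_set [set s | f s != 0]] in
  F 0 /\ forall a u v, F u -> F v -> F (a *: u + v).
Proof.
split=> /= [|a u v fu fv].
  apply: (sub_finite_set _ (finite_set0 S)) => s /=.
  by rewrite eqxx.
apply: (@sub_finite_set _ _ ([set s | u s != 0] `|` [set s | v s != 0])).
  move=> s /= nz; case: (eqVneq (u s) 0) => [us|]; last by left.
  right; apply: contra_neq nz => vs.
  by rewrite -[LHS]/(a *: u s + v s) us vs scaler0 addr0.
by rewrite finite_setU.
Qed.

(* Finitely supported functions; [fgen s] is the basis element at [s]. *)
Definition freemod : lmodType K := lsub_of (LSubspace finsupp_closed).

Lemma fgen_subproof (s : S) :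
  (fun t => (t == s)%:R : K^o) \in lsubspace_pred (LSubspace finsupp_closed).
Proof.
apply: mem_set => /=; apply: (sub_finite_set _ (finite_set1 s)) => t /=.
by have [->//|_] := eqVneq t s; rewrite eqxx.
Qed.

Definition fgen (s : S) : freemod := LSub (fgen_subproof s).

Definition fcoef (f : freemod) : S -> K := lsub_val f.

Lemma fcoef_fin (f : freemod) : finite_set [set s | fcoef f s != 0].
Proof. by have /set_mem := valP f. Qed.

Lemma free_expand (f : freemod) (r : seq S) : uniq r ->
  (forall s, fcoef f s != 0 -> s \in r) -> f = \sum_(s <- r) fcoef f s *: fgen s.
Proof.
move=> ur fr; apply: val_inj; apply/funext => t /=.
rewrite (raddf_sum (@lsub_val _ _ _)) fct_sumE.
have -> : lsub_val f t = fcoef f t by [].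
have [tr|tr] := boolP (t \in r).
  rewrite (bigD1_seq t)//= big1 => [|s st]; last first.
    by rewrite -[LHS]/(fcoef f s * (t == s)%:R) eq_sym (negPf st) mulr0.
  by rewrite addr0 -[RHS]/(fcoef f t * (t == t)%:R) eqxx mulr1.
have /eqP -> : fcoef f t == 0 by apply: contraNT tr; exact: fr.
rewrite big_seq big1// => s sr.
rewrite -[LHS]/(fcoef f s * (t == s)%:R) (_ : (t == s) = false) ?mulr0//.
by apply: contraNF tr => /eqP ->.
Qed.

Lemma free_univ (P : lmodType K) (g : S -> P) :
  exists f : {linear freemod -> P}, forall s, f (fgen s) = g s.
Proof.
pose h (f : freemod) : P := \sum_(s <- fset_set [set s | fcoef f s != 0]) fcoef f s *: g s.
have hE (r : seq S) f : uniq r -> (forall s, fcoef f s != 0 -> s \in r) ->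
    h f = \sum_(s <- r) fcoef f s *: g s.
  move=> ur fr; rewrite /h.
  rewrite [RHS](bigID (fun s => fcoef f s != 0))/= [X in _ + X]big1 ?addr0; last first.
    by move=> s /negPn/eqP ->; rewrite scale0r.
  rewrite -[RHS]big_filter; apply: perm_big; apply: uniq_perm.
  - exact: fset_uniq.
  - exact: filter_uniq.
  - move=> s; rewrite mem_filter in_fset_set; last exact: fcoef_fin.
    apply/idP/andP => [/set_mem /= nz|[nz _]]; last exact: mem_set.
    by split=> //; exact: fr.
have hl : linear h.
  move=> a u v.
  pose r := undup (enum_fset (fset_set [set s | fcoef u s != 0]) ++
                   enum_fset (fset_set [set s | fcoef v s != 0])).
  have ur : uniq r by exact: undup_uniq.
  have ru s : fcoef u s != 0 -> s \in r.
    move=> nz; rewrite mem_undup mem_cat; apply/orP; left.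
    by rewrite in_fset_set; [exact: mem_set|exact: fcoef_fin].
  have rv s : fcoef v s != 0 -> s \in r.
    move=> nz; rewrite mem_undup mem_cat; apply/orP; right.
    by rewrite in_fset_set; [exact: mem_set|exact: fcoef_fin].
  have cE s : fcoef (a *: u + v) s = a * fcoef u s + fcoef v s by [].
  rewrite (hE r u)// (hE r v)// (hE r)//; last first.
    move=> s; rewrite cE; have [us0|/ru//] := eqVneq (fcoef u s) 0.
    have [vs0|/rv//] := eqVneq (fcoef v s) 0.
    by rewrite us0 vs0 mulr0 addr0 eqxx.
  rewrite scaler_sumr -big_split; apply: eq_bigr => s _ /=.
  by rewrite scalerA -scalerDl.
have [f fE] := mk_linear hl; exists f => s; rewrite fE (hE [:: s])//.
  by rewrite big_seq1 -[fcoef _ _]/((s == s)%:R) eqxx scale1r.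
move=> t; rewrite -[fcoef _ _]/((t == s)%:R) inE.
by case: (t == s); rewrite ?eqxx.
Qed.

Lemma free_ext (P : lmodType K) (f g : {linear freemod -> P}) :
  (forall s, f (fgen s) = g (fgen s)) -> f =1 g.
Proof.
move=> fg x; rewrite (@free_expand x (fset_set [set s | fcoef x s != 0])).
- by rewrite !linear_sum; apply: eq_bigr => s _; rewrite !linearZ fg.
- exact: fset_uniq.
- by move=> s nz; rewrite in_fset_set; [exact: mem_set|exact: fcoef_fin].
Qed.

End FreeModules.
Arguments fgen {K S} s.

Section TensorProduct.
Variables (K : fieldType).
Implicit Types M N P : lmodType K.

Variant tens_rel M N : set (freemod K (M * N)%type) :=
| TensRelL a m m' n : tens_rel
    (fgen (a *: m + m', n) - (a *: fgen (m, n) + fgen (m', n)))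
| TensRelR a m n n' : tens_rel
    (fgen (m, a *: n + n') - (a *: fgen (m, n) + fgen (m, n'))).

Definition tens M N : lmodType K := lquot (spanS (@tens_rel M N)).

Definition tensor M N (m : M) (n : N) : tens M N :=
  lproj (spanS (@tens_rel M N)) (fgen (m, n)).

Local Notation "x ⊗ y" := (tensor x y).

Lemma tensorPl M N a (m m' : M) (n : N) :
  (a *: m + m') ⊗ n = a *: (m ⊗ n) + m' ⊗ n.
Proof.
rewrite /tensor -linearP; apply/eqP; rewrite [_ == _]lproj_eqE.
by apply: mem_set; apply: sub_spanS; left.
Qed.

Lemma tensorPr M N a (m : M) (n n' : N) :
  m ⊗ (a *: n + n') = a *: (m ⊗ n) + m ⊗ n'.
Proof.
rewrite /tensor -linearP; apply/eqP; rewrite [_ == _]lproj_eqE.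
by apply: mem_set; apply: sub_spanS; right.
Qed.

Lemma tens_univ M N P (b : M -> N -> P) :
  (forall n, linear (b^~ n)) -> (forall m, linear (b m)) ->
  exists f : {linear tens M N -> P}, forall m n, f (m ⊗ n) = b m n.
Proof.
move=> bl br; have [f fE] := free_univ (fun p : M * N => b p.1 p.2).
have /lquot_univ[g gE] : forall x, x \in spanS (@tens_rel M N) -> f x = 0.
  apply: spanS_ker => _ [a m m' n|a m n n'];
    by rewrite linearB linearP !fE/= ?(bl n) ?(br m) subrr.
by exists g => m n; rewrite gE fE.
Qed.

Lemma tens_ext M N P (f g : {linear tens M N -> P}) :
  (forall m n, f (m ⊗ n) = g (m ⊗ n)) -> f =1 g.
Proof.
move=> fg; apply: lquot_ext => x.
by apply: (free_ext (f := f \o lproj _) (g := g \o lproj _)) => -[m n]; exact: fg.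
Qed.

Definition tens_map M N M' N' (f : {linear M -> M'}) (g : {linear N -> N'}) :
    {linear tens M N -> tens M' N'} :=
  get [set h : {linear tens M N -> tens M' N'} |
        forall m n, h (m ⊗ n) = f m ⊗ g n].

Definition tens_assoc M N P :
    {linear tens (tens M N) P -> tens M (tens N P)} :=
  get [set h : {linear tens (tens M N) P -> tens M (tens N P)} |
        forall m n p, h (m ⊗ n ⊗ p) = m ⊗ (n ⊗ p)].

Lemma tens_mapE M N M' N' (f : {linear M -> M'}) (g : {linear N -> N'}) m n :
  tens_map f g (m ⊗ n) = f m ⊗ g n.
Proof.
have [h hE] := @tens_univ M N _ (fun m n => f m ⊗ g n)
  (fun n a m m' => etrans (congr1 (fun x => x ⊗ g n) (linearP f a m m'))
     (tensorPl a (f m) (f m') (g n)))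
  (fun m a n n' => etrans (congr1 (fun x => f m ⊗ x) (linearP g a n n'))
     (tensorPr a (f m) (g n) (g n'))).
by have /(_ m n) := getPex (ex_intro [set h : {linear _ -> _} |
  forall m n, h (m ⊗ n) = f m ⊗ g n] h hE).
Qed.

Lemma tens_assocE M N P (m : M) (n : N) (p : P) :
  tens_assoc M N P (m ⊗ n ⊗ p) = m ⊗ (n ⊗ p).
Proof.
have /choice[h hE] : forall p : P, exists h : {linear tens M N -> _},
    forall m n, h (m ⊗ n) = m ⊗ (n ⊗ p).
  move=> q; apply: tens_univ => [y|x] a x1 x2; first exact: tensorPl.
  by rewrite tensorPl tensorPr.
have [] := @tens_univ (tens M N) P _ (fun t p => h p t).
- by move=> q a s t; rewrite linearP.
- move=> t a q q'.
  pose h1 : {linear tens M N -> _} := h (a *: q + q').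
  have /mk_linear[h2 h2E] : linear (fun t => a *: h q t + h q' t).
    move=> b x y; rewrite (linearP (h q)) (linearP (h q')).
    by rewrite !scalerDr !scalerA mulrC addrACA.
  rewrite -[LHS]/(h1 t) -h2E; apply: tens_ext => x y.
  by rewrite h2E !hE !tensorPr.
move=> f fE; have := getPex (ex_intro [set h : {linear _ -> _} |
  forall m n p, h (m ⊗ n ⊗ p) = m ⊗ (n ⊗ p)] f _).
by apply=> x y z; rewrite fE hE.
Qed.

End TensorProduct.
Notation "x ⊗ y" := (tensor x y) : ring_scope.

Section ExteriorAlgebra.
Variables (K : fieldType).
Implicit Types M N : lmodType K.

(* The free module on the lists over [M], modulo multilinearity, is the tensor
   algebra of [M]; [ExtAlt] generates the two-sided ideal of the x ⊗ x. *)
Variant ext_rel M : set (freemod K (seq M)) :=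
| ExtLin s t a x y : ext_rel
    (fgen (s ++ (a *: x + y) :: t) -
       (a *: fgen (s ++ x :: t) + fgen (s ++ y :: t)))
| ExtAlt s t x : ext_rel (fgen (s ++ [:: x, x & t])).

Definition ext M : lmodType K := lquot (spanS (@ext_rel M)).

(* The product x_1 ∧ ... ∧ x_k for s = [:: x_1; ...; x_k] *)
Definition ext_mon M (s : seq M) : ext M := lproj (spanS (@ext_rel M)) (fgen s).

Definition wedge_map M : {linear tens (ext M) (ext M) -> ext M} :=
  get [set f : {linear tens (ext M) (ext M) -> ext M} |
        forall s t, f (ext_mon s ⊗ ext_mon t) = ext_mon (s ++ t)].

Definition wedge M (u v : ext M) : ext M := wedge_map M (u ⊗ v).

Definition ext_map M N (f : {linear M -> N}) : {linear ext M -> ext N} :=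
  get [set g : {linear ext M -> ext N} |
        forall s, g (ext_mon s) = ext_mon (map f s)].

Definition ext_pow M (k : nat) : lsubspace (ext M) :=
  spanS [set ext_mon s | s in [set s : seq M | size s = k]].

Definition homogeneous M (u : ext M) := exists k, u \in ext_pow M k.

Lemma ext_univ M (P : lmodType K) (g : seq M -> P) :
  (forall s t a x y, g (s ++ (a *: x + y) :: t) =
     a *: g (s ++ x :: t) + g (s ++ y :: t)) ->
  (forall s t x, g (s ++ [:: x, x & t]) = 0) ->
  exists f : {linear ext M -> P}, forall s, f (ext_mon s) = g s.
Proof.
move=> gl ga; have [f fE] := free_univ g.
have /lquot_univ[h hE] : forall x, x \in spanS (@ext_rel M) -> f x = 0.
  apply: spanS_ker => _ [s t a x y|s t x]; last by rewrite fE ga.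
  by rewrite linearB linearP !fE gl subrr.
by exists h => s; rewrite hE fE.
Qed.

Lemma ext_ext M (P : lmodType K) (f g : {linear ext M -> P}) :
  (forall s, f (ext_mon s) = g (ext_mon s)) -> f =1 g.
Proof.
move=> fg; apply: lquot_ext => x.
by apply: (free_ext (f := f \o lproj _) (g := g \o lproj _)) => s; exact: fg.
Qed.

Lemma ext_mon_lin M s t a (x y : M) : ext_mon (s ++ (a *: x + y) :: t) =
  a *: ext_mon (s ++ x :: t) + ext_mon (s ++ y :: t).
Proof.
rewrite /ext_mon -linearP; apply/eqP; rewrite [_ == _]lproj_eqE.
by apply: mem_set; apply: sub_spanS; left.
Qed.

Lemma ext_mon_alt M s t (x : M) : ext_mon (s ++ [:: x, x & t]) = 0.
Proof.
rewrite /ext_mon -[RHS](linear0 (lproj _)); apply/eqP.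
by rewrite [_ == _]lproj_eqE subr0; apply: mem_set; apply: sub_spanS; right.
Qed.

Lemma ext_mapE M N (f : {linear M -> N}) s :
  ext_map f (ext_mon s) = ext_mon (map f s).
Proof.
have [||h hE] := @ext_univ M (ext N) (fun s => ext_mon (map f s)).
- by move=> s' t a x y; rewrite !map_cat/= linearP ext_mon_lin.
- by move=> s' t x; rewrite map_cat/= ext_mon_alt.
by have /(_ s) := getPex (ex_intro [set g : {linear _ -> _} |
  forall s, g (ext_mon s) = ext_mon (map f s)] h hE).
Qed.

Lemma wedgeE M (s t : seq M) : wedge (ext_mon s) (ext_mon t) = ext_mon (s ++ t).
Proof.
have /choice[r rE] : forall t, exists f : {linear ext M -> ext M},
    forall s, f (ext_mon s) = ext_mon (s ++ t).
  move=> q; apply: ext_univ => [s' t' a x y|s' t' x].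
    by rewrite -!catA !cat_cons ext_mon_lin.
  by rewrite -!catA !cat_cons ext_mon_alt.
have /choice[l lE] : forall u, exists f : {linear ext M -> ext M},
    forall t, f (ext_mon t) = r t u.
  move=> u; apply: ext_univ => [s' t' a x y|s' t' x].
    have /mk_linear[h hE] : linear (fun u => a *: r (s' ++ x :: t') u + r (s' ++ y :: t') u).
      move=> b u1 u2; rewrite (linearP (r (s' ++ x :: t'))) (linearP (r (s' ++ y :: t'))).
      by rewrite !scalerDr !scalerA mulrC addrACA.
    rewrite -hE; apply: ext_ext => q.
    by rewrite hE !rE !catA ext_mon_lin.
  pose z : {linear ext M -> ext M} := \0.
  by rewrite -[RHS]/(z u); apply: ext_ext => q; rewrite rE catA ext_mon_alt.
have [] := @tens_univ K (ext M) (ext M) (ext M) (fun u v => l u v).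
- move=> v a u u'.
  have /mk_linear[h hE] : linear (fun v => a *: l u v + l u' v).
    move=> b v1 v2; rewrite (linearP (l u)) (linearP (l u')).
    by rewrite !scalerDr !scalerA mulrC addrACA.
  rewrite -hE; apply: ext_ext => q.
  by rewrite hE !lE linearP.
- by move=> u a v v'; rewrite linearP.
move=> f fE; have := getPex (ex_intro [set f : {linear _ -> _} |
  forall s t, f (ext_mon s ⊗ ext_mon t) = ext_mon (s ++ t)] f _).
by apply=> x y; rewrite fE lE rE.
Qed.

End ExteriorAlgebra.
Notation "u ∧ v" := (wedge u v) : ring_scope.

Section Determinants.
Variables (K : fieldType).
Implicit Types (M L : lmodType K).

Definition has_dim M (n : nat) := exists e : 'I_n -> M,
  forall v, exists! c : 'I_n -> K, v = \sum_i c i *: e i.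

Definition finite_dim M := exists n, has_dim M n.

Definition dim M : nat := get [set n | has_dim M n].

(* [L] is meant to be a line. *)
Definition generator L (x : L) := x != 0 /\ forall y, exists a : K, y = a *: x.

Lemma dual_closed L :
  let D := [set f : L -> K^o | forall a x y, f (a *: x + y) = a * f x + f y] in
  D 0 /\ forall a u v, D u -> D v -> D (a *: u + v).
Proof.
split=> [a x y|a u v Du Dv b x y]; first by rewrite mulr0 addr0.
rewrite -[LHS]/(a * u _ + v _) Du Dv -[(_ + v) x]/(a * u x + v x).
by rewrite -[(_ + v) y]/(a * u y + v y) !mulrDr !mulrA [b * a]mulrC addrACA.
Qed.

Definition dual L : lmodType K := lsub_of (LSubspace (@dual_closed L)).

(* The dual generator x^* of a generator [x] of a line. *)
Definition dual_gen L (x : L) : dual L :=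
  xget 0 [set f : dual L | lsub_val f x = 1].

(* The top exterior power, as the subspace of degree [dim M] of [ext M]. *)
Definition Det M : lmodType K := lsub_of (ext_pow M (dim M)).

(* [u] lies in the top exterior power, as [g], and generates it. *)
Definition det_gen M (u : ext M) (g : Det M) :=
  lsub_val g = u /\ generator g.

End Determinants.

Section FredholmDeterminants.
Variables (K : fieldType) (H : lmodType K).
Implicit Types X Y V W : lsubspace H.

Definition coker V W : lmodType K := lquot (addS V W).

Definition DetP V W : lmodType K :=
  tens (Det (lsub_of (capS V W))) (dual (Det (coker V W))).

(* S(X,Y), for X ∩ Y = 0: xi ⊗ eta is mapped to xi ∧ eta, where xi and eta are
   viewed in the exterior algebra of X + Y. *)
Definition SDet X Y : {linear tens (Det (lsub_of X)) (Det (lsub_of Y)) ->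
                            Det (lsub_of (addS X Y))} :=
  get [set f : {linear tens (Det (lsub_of X)) (Det (lsub_of Y)) ->
                       Det (lsub_of (addS X Y))} |
    forall xi eta, lsub_val (f (xi ⊗ eta)) =
      ext_map (lincl X (addS X Y)) (lsub_val xi) ∧
      ext_map (lincl Y (addS X Y)) (lsub_val eta)].

(* The exact sequence, for X ∩ V = 0,
     0 -> V ∩ W -> (X + V) ∩ W -> X -> H/(V + W) -> H/(X + V + W) -> 0
   has the arrows [seqT1], [seqT2], [seqT3], [seqT4]. *)
Definition seqT1 X V W :
    {linear lsub_of (capS V W) -> lsub_of (capS (addS X V) W)} :=
  lincl (capS V W) (capS (addS X V) W).

Definition seqT2 X V W : {linear lsub_of (capS (addS X V) W) -> lsub_of X} :=
  get [set f : {linear lsub_of (capS (addS X V) W) -> lsub_of X} |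
    forall u (x : lsub_of X) (v : lsub_of V),
      lsub_val u = lsub_val x + lsub_val v -> f u = x].

Definition seqT3 X V W : {linear lsub_of X -> coker V W} :=
  lproj (addS V W) \o @lsub_val K H X.

Definition seqT4 X V W : {linear coker V W -> coker (addS X V) W} :=
  get [set f : {linear coker V W -> coker (addS X V) W} |
    forall h, f (lproj (addS V W) h) = lproj (addS (addS X V) W) h].

(* [a1], ..., [a4] are as required in the definition of S(X,(V,W)); [g1], ...,
   [g5] are the resulting generators of the determinants of the five terms. *)
Record adapted X V W
    (a1 : ext (lsub_of (capS V W))) (a2 : ext (lsub_of (capS (addS X V) W)))
    (a3 : ext (lsub_of X)) (a4 : ext (coker V W))
    (g1 : Det (lsub_of (capS V W))) (g2 : Det (lsub_of (capS (addS X V) W)))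
    (g3 : Det (lsub_of X)) (g4 : Det (coker V W))
    (g5 : Det (coker (addS X V) W)) : Prop := Adapted {
  adapted_hom1 : homogeneous a1;
  adapted_hom2 : homogeneous a2;
  adapted_hom3 : homogeneous a3;
  adapted_hom4 : homogeneous a4;
  adapted_gen1 : det_gen a1 g1;
  adapted_gen2 : det_gen (ext_map (seqT1 X V W) a1 ∧ a2) g2;
  adapted_gen3 : det_gen (ext_map (seqT2 X V W) a2 ∧ a3) g3;
  adapted_gen4 : det_gen (ext_map (seqT3 X V W) a3 ∧ a4) g4;
  adapted_gen5 : det_gen (ext_map (seqT4 X V W) a4) g5 }.

(* S(X,(V,W)), for X ∩ V = 0. Its defining identity is imposed for all adapted
   data, on whose choice it does not depend. The subtraction d4 - d5 is not
   truncated, since [seqT4] is onto. *)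
Definition SPair X V W :
    {linear tens (Det (lsub_of X)) (DetP V W) -> DetP (addS X V) W} :=
  let d1 := dim (lsub_of (capS V W)) in
  let d3 := dim (lsub_of X) in
  let d4 := dim (coker V W) in
  let d5 := dim (coker (addS X V) W) in
  get [set f : {linear tens (Det (lsub_of X)) (DetP V W) ->
                       DetP (addS X V) W} |
    forall a1 a2 a3 a4 g1 g2 g3 g4 g5,
      @adapted X V W a1 a2 a3 a4 g1 g2 g3 g4 g5 ->
      f (g3 ⊗ (g1 ⊗ dual_gen g4)) =
        (-1) ^+ (d3 * d1 + d5 * (d4 - d5))%N *: (g2 ⊗ dual_gen g5)].

End FredholmDeterminants.

Variant scalar_kind := RealScalars | ComplexScalars.

Definition scalars (R : realType) (k : scalar_kind) : numFieldType :=
  match k with RealScalars => R | ComplexScalars => R[i] end.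

Definition scalar_conj (R : realType) (k : scalar_kind) :
    scalars R k -> scalars R k :=
  match k with RealScalars => idfun | ComplexScalars => @conjc R end.

Definition separable_space (T : topologicalType) :=
  exists2 D : set T, countable D & dense D.

Definition fredholm_pair (K : numFieldType) (H : normedModType K)
    (V W : lsubspace H) :=
  [/\ closed V, closed W, finite_dim (lsub_of (capS V W))
    & finite_dim (coker V W)].

(* Main.v *)
Require Import Defs.
From HB Require Import structures.
From mathcomp Require Import all_boot all_order all_algebra.
From mathcomp Require Import complex sesquilinear.
From mathcomp Require Import all_classical all_reals all_analysis.
From mathcomp Require Import ring.

Set Implicit Arguments.
Unset Strict Implicit.
Unset Printing Implicit Defensive.

Import Order.TTheory GRing.Theory Num.Theory numFieldNormedType.Exports.
Local Open Scope classical_set_scope.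
Local Open Scope ring_scope.

(** The identity is checked on one generator of the source, which is a line, and
    in bases that serve all three exact sequences.

    Let X ∩ V = 0. Take lists of vectors of H: a basis a of V ∩ W, a basis b of
    (X + V) ∩ W modulo V ∩ W, a basis c of X + V + W modulo V + W with entries
    in X, and a basis d of H modulo X + V + W. If p b denotes the components of
    b in X, then the monomials a, a ∧ b, p b ∧ c, c ∧ d and d generate the five
    determinants, because p b is a basis of the kernel X ∩ (V + W) of T3
    (flag_basis_ker3), and S(X,(V,W)) maps (p b ∧ c) ⊗ a ⊗ (c ∧ d)^* to
    (a ∧ b) ⊗ d^*, up to the sign of its definition (SPair_flag). This rests on
    the independence of S(X,(V,W)) of the choices. Other adapted elements replace
    the five generators by their multiples by k1, k1 k2, k2 k3, k3 k4 and k4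
    (adapted_scalars), and these scalars cancel. Each k_i occurs in two
    determinants since, by exactness, the wedge product with the generator of the
    kernel of T_i and the image under T_i both depend only on the class of a_i
    modulo this kernel, which lies on a line (exact_step). What makes such classes
    lie on a line is that a map that vanishes on the monomials with a factor in N
    is determined, in the degree of the codimension of N, by its value on the
    monomial of a basis modulo N (kills_span).

    Let now a, b2, b3 and d be such bases for Y and (V,W), and let a ++ b2, c2,
    c3, c4 be such bases for X and (Y + V,W). Then d may be replaced by c3 ++ c4,
    and a, b2 ++ c2, b3 ++ c3, c4 are such bases for X + Y and (V,W) (flag_sum).
    Hence the target of S(Y,(V,W)) appears with the generator that S(X,(Y + V,W))
    expects, and both sides of the identity give plus or minus
    (a ∧ b2 ∧ c2) ⊗ c4^*. The generator of Det(X + Y) for the third sequence is a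
    permutation of the product of the generators for X and Y (mon_sum), and the
    exponents of the signs have the same parity (sign_sum). *)

(** * Bases of a subspace modulo a smaller one *)

(** A coercion to functions, so that membership in V can be written V x. *)
Definition lsub_mem (K : fieldType) (M : lmodType K) (V : lsubspace M) : M -> Prop :=
  lsubspace_set V.
Coercion lsub_mem : lsubspace >-> Funclass.

Section RelativeBases.
Variables (K : fieldType) (M : lmodType K).
Implicit Types (V W N S T : lsubspace M) (x y : M) (s t : seq M).

Lemma sub0S V : V 0.
Proof. by have [] := lsubspace_closed V. Qed.

Lemma subPS V a x y : V x -> V y -> V (a *: x + y).
Proof. by have [_] := lsubspace_closed V; apply. Qed.

Lemma subZS V a x : V x -> V (a *: x).
Proof. by move=> Vx; rewrite -[_ *: _]addr0; apply: subPS => //; exact: sub0S. Qed.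

Lemma subDS V x y : V x -> V y -> V (x + y).
Proof. by move=> Vx Vy; rewrite -[x]scale1r; exact: subPS. Qed.

Lemma subNS V x : V x -> V (- x).
Proof. by move=> Vx; rewrite -scaleN1r; exact: subZS. Qed.

Lemma subBS V x y : V x -> V y -> V (x - y).
Proof. by move=> Vx Vy; apply: subDS => //; exact: subNS. Qed.

Lemma lsub_ext V W : (forall x, V x <-> W x) -> V = W.
Proof. by move=> VW; apply/lsubspace_eq/seteqP; split=> x /VW. Qed.

Lemma zeroS_closed : let Z := [set 0] : set M in
  Z 0 /\ forall a u v, Z u -> Z v -> Z (a *: u + v).
Proof. by split=> //= a u v -> ->; rewrite scaler0 addr0. Qed.
Definition zeroS := LSubspace zeroS_closed.

Lemma fullS_closed : let Z := setT : set M in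
  Z 0 /\ forall a u v, Z u -> Z v -> Z (a *: u + v).
Proof. by []. Qed.
Definition fullS := LSubspace fullS_closed.

Lemma adjS_closed N x : let Z := [set v | exists c, N (v - c *: x)] in
  Z 0 /\ forall a u v, Z u -> Z v -> Z (a *: u + v).
Proof.
split=> [|a u v [c Nu] [d Nv]] /=.
  by exists 0; rewrite scale0r subr0; exact: sub0S.
exists (a * c + d); have := subPS a Nu Nv.
by rewrite scalerBr scalerA scalerDl opprD addrACA.
Qed.
Definition adjS N x := LSubspace (adjS_closed N x).

Lemma adjS_sub N x y : N y -> adjS N x y.
Proof. by exists 0; rewrite scale0r subr0. Qed.

Lemma adjS_gen N x : adjS N x x.
Proof. by exists 1; rewrite scale1r subrr; exact: sub0S. Qed.

Lemma adjS_id N x : N x -> adjS N x = N.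
Proof.
move=> Nx; apply: lsub_ext => v; split; last exact: adjS_sub.
by move=> [c Nv]; rewrite -(subrK (c *: x) v); apply: subDS => //; exact: subZS.
Qed.

Lemma adjS_congr N x y : N (x - y) -> adjS N x = adjS N y.
Proof.
move=> Nxy; apply: lsub_ext => v.
have E c : v - c *: y = v - c *: x + c *: (x - y).
  by rewrite scalerBr addrA subrK.
split=> -[c Nv]; exists c; first by rewrite E; apply: subDS => //; exact: subZS.
by rewrite -(addrK (c *: (x - y)) (v - _)) -E; apply: subBS => //; exact: subZS.
Qed.

(** The modular law, for the line spanned by x. *)
Lemma capS_adjS N W x : W x -> capS (adjS N x) W = adjS (capS N W) x.
Proof.
move=> Wx; apply: lsub_ext => v; split.
  by move=> [[c Nv] Wv]; exists c; split=> //; apply: subBS => //; exact: subZS.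
move=> [c [Nv Wv]]; split; first by exists c.
by rewrite -(subrK (c *: x) v); apply: subDS => //; exact: subZS.
Qed.

Lemma addS_adjS N T x : addS T (adjS N x) = adjS (addS T N) x.
Proof.
apply: lsub_ext => v; split.
  move=> [t Tt [n [c Nn] <-]]; exists c; exists t => //; exists (n - c *: x) => //.
  by rewrite addrA.
move=> [c [t Tt [n Nn e]]]; exists t => //; exists (n + c *: x).
  by exists c; rewrite addrK.
by rewrite addrA e subrK.
Qed.

(** Adjoining the entries to N one at a time makes the concatenation of bases
    and the isomorphism theorems below plain inductions. *)
Fixpoint basis_mod N S s :=
  if s is x :: s' then ~ N x /\ basis_mod (adjS N x) S s' else N = S.

Lemma basis_mod_span N S s : basis_mod N S s -> foldl adjS N s = S.
Proof. by elim: s N => [|x s IH] N //= [_ /IH]. Qed.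

Lemma basis_mod_sub N S s y : basis_mod N S s -> N y -> S y.
Proof.
elim: s N => [|x s IH] N /= => [->//|[_ /IH]] + Ny.
by apply; exact: adjS_sub.
Qed.

Lemma basis_mod_in N S s y : basis_mod N S s -> y \in s -> S y.
Proof.
elim: s N => [//|x s IH] N /= [_ b]; rewrite in_cons => /predU1P[->|]; last exact: IH b.
exact: basis_mod_sub b (adjS_gen N x).
Qed.

Lemma basis_mod_cat N S T s t :
  basis_mod N S s -> basis_mod S T t -> basis_mod N T (s ++ t).
Proof. by elim: s N => [|x s IH] N /= => [->//|[? /IH]] + ?; split; auto. Qed.

Lemma basis_mod_congr (f : M -> M) N S s : (forall x, x \in s -> N (x - f x)) ->
  basis_mod N S s -> basis_mod N S (map f s).
Proof.
elim: s N => [//|x s IH] N /= h [Nx b].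
have Nxf : N (x - f x) by apply: h; rewrite mem_head.
split; first by move=> Nf; apply: Nx; rewrite -(subrK (f x) x); exact: subDS.
rewrite -(adjS_congr Nxf); apply: IH => // y ys.
by apply: adjS_sub; apply: h; rewrite in_cons ys orbT.
Qed.

(** The injection of (S ∩ W) / (N ∩ W) into S / N, read on bases. *)
Lemma basis_mod_cap N S W s : (forall x, x \in s -> W x) ->
  basis_mod N S s -> basis_mod (capS N W) (capS S W) s.
Proof.
elim: s N => [N _ ->//|x s IH] N /= h [Nx b].
have Wx : W x by apply: h; rewrite mem_head.
split=> [[//]|]; rewrite -capS_adjS//; apply: IH => // y ys.
by apply: h; rewrite in_cons ys orbT.
Qed.

(** The isomorphism of S / (N ∩ W) onto (N + S) / N, read on bases. *)
Lemma basis_mod_add N S W s : (forall x, x \in s -> W x) ->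
  basis_mod (capS N W) S s -> basis_mod N (addS N S) s.
Proof.
elim: s N => [N _ <-|x s IH N /= h].
  apply: lsub_ext => v; split=> [Nv|[n Nn [w [Nw _] <-]]]; last exact: subDS.
  by exists v => //; exists 0; [exact: (sub0S (capS N W))|rewrite addr0].
move=> [NWx b]; have Wx : W x by apply: h; rewrite mem_head.
split; first by move=> Nx; exact: NWx.
have Sx : S x by apply: basis_mod_sub b (adjS_gen _ x).
have -> : addS N S = addS (adjS N x) S.
  apply: lsub_ext => v; split=> [[n Nn [y Sy <-]]|[n [c Nn] [y Sy <-]]].
    by exists n; [exact: adjS_sub|exists y].
  exists (n - c *: x) => //; exists (c *: x + y); last by rewrite addrA subrK.
  exact: subPS.
apply: IH => [y ys|]; first by apply: h; rewrite in_cons ys orbT.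
by rewrite capS_adjS.
Qed.

(** Adjoining x to N enlarges N ∩ W by at most one vector, which is not x in
    general. *)
Lemma exists_basis_cap N S W s : basis_mod N S s ->
  exists t, basis_mod (capS N W) (capS S W) t.
Proof.
elim: s N => [N ->|x s IH N /= [Nx /IH[t tb]]]; first by exists [::].
have [[w [[c Nw] Ww] nNw]|none] := pselect (exists2 w, capS (adjS N x) W w & ~ N w).
  exists (w :: t); split; first by move=> [].
  rewrite -capS_adjS//; suff -> : adjS N w = adjS N x by [].
  have c0 : c != 0.
    by apply: contra_notN nNw => /eqP c0; move: Nw; rewrite c0 scale0r subr0.
  rewrite (adjS_congr Nw); apply: lsub_ext => v; split=> -[d Nv].
    by exists (d * c); rewrite -scalerA.
  by exists (d / c); rewrite scalerA divfK.
exists t; suff <- : capS (adjS N x) W = capS N W by [].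
apply: lsub_ext => v; split=> [Av|[Nv Wv]]; last by split=> //; exact: adjS_sub.
by split; [apply: contrapT => nNv; apply: none; exists v|case: Av].
Qed.

(** Keep the entries that enlarge the span of T, N and the preceding ones. *)
Lemma exists_basis_add N S T s : basis_mod N S s ->
  exists2 t, {subset t <= s} & basis_mod (addS T N) (addS T S) t.
Proof.
elim: s N => [N ->|x s IH N /= [Nx /IH[t ts]]]; first by exists [::].
rewrite addS_adjS; have [/adjS_id-> tb|nx tb] := pselect (addS T N x).
  by exists t => // y /ts; rewrite in_cons orbC => ->.
exists (x :: t) => // y; rewrite !in_cons => /orP[->//|/ts->].
by rewrite orbT.
Qed.

Lemma foldl_adjS_sub N s y : N y -> foldl adjS N s y.
Proof. by elim: s N => [//|x s IH] N Ny /=; apply: IH; exact: adjS_sub. Qed.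

Lemma foldl_adjS_in N s y : y \in s -> foldl adjS N s y.
Proof.
elim: s N => [//|x s IH] N /=; rewrite in_cons => /predU1P[->|]; last exact: IH.
by apply: foldl_adjS_sub; exact: adjS_gen.
Qed.

Lemma foldl_adjS_basis N s :
  exists2 t, {subset t <= s} & basis_mod N (foldl adjS N s) t.
Proof.
elim: s N => [N|x s IH N /=]; first by exists [::].
have [t ts tb] := IH (adjS N x).
have [Nx|Nx] := pselect (N x).
  exists t; last by rewrite -{1}(adjS_id Nx).
  by move=> y /ts; rewrite in_cons orbC => ->.
exists (x :: t) => // y; rewrite !in_cons => /orP[->//|/ts->].
by rewrite orbT.
Qed.

Lemma basis_mod_coord N S s : basis_mod N S s -> forall v, S v ->
  exists! c : 'I_(size s) -> K, N (v - \sum_i c i *: s`_i).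
Proof.
elim: s N => [N -> v Sv|x s IH N /= [Nx b] v Sv].
  exists (fun=> 0); split=> [|c _]; first by rewrite big_ord0 subr0.
  by apply/funext => -[].
have [c [[d Nc] cu]] := IH _ b v Sv.
exists (fun i => if unlift ord0 i is Some j then c j else d); split.
  rewrite big_ord_recl/= unlift_none.
  under eq_bigr do rewrite liftK.
  by rewrite opprD addrA addrAC.
move=> c' Nc'.
have E : v - \sum_i c' i *: (x :: s)`_i =
    v - (\sum_(i < size s) c' (lift ord0 i) *: s`_i) - c' ord0 *: x.
  by rewrite big_ord_recl/= opprD addrA addrAC.
have cE : c = fun i => c' (lift ord0 i).
  by apply: cu; exists (c' ord0); rewrite -E.
apply/funext => i; case: (unliftP ord0 i) => [j ->|->]; first by rewrite cE.
apply: contrapT => /eqP; rewrite -subr_eq0 => ne; apply: Nx.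
have : N ((d - c' ord0) *: x).
  move: Nc'; rewrite E => Nc'; have := subBS Nc' Nc.
  by rewrite cE opprB addrC addrA subrK scalerBl.
by move=> /(subZS (d - c' ord0)^-1); rewrite scalerA mulVf// scale1r.
Qed.

End RelativeBases.

Section Transport.
Variables (K : fieldType) (M P : lmodType K) (f : {linear M -> P}).

Lemma preS_closed (N : lsubspace P) : let Z := [set x | N (f x)] in
  Z 0 /\ forall a u v, Z u -> Z v -> Z (a *: u + v).
Proof.
split=> /= [|a u v Nu Nv]; first by rewrite linear0; exact: sub0S.
by rewrite linearP; exact: subPS.
Qed.
Definition preS N := LSubspace (preS_closed N).

Lemma preS_adjS N x : preS (adjS N (f x)) = adjS (preS N) x.
Proof.
have E v c : f (v - c *: x) = f v - c *: f x by rewrite linearB linearZ.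
by apply: lsub_ext => v; split=> -[c h]; exists c; move: h; rewrite /= E.
Qed.

Lemma basis_mod_pre N S s :
  basis_mod N S (map f s) -> basis_mod (preS N) (preS S) s.
Proof.
elim: s N => [N ->//|x s IH N /= [Nx b]]; split=> //.
by rewrite -preS_adjS; exact: IH.
Qed.

Lemma basis_mod_im N S s : (forall y, exists x, f x = y) ->
  basis_mod (preS N) (preS S) s -> basis_mod N S (map f s).
Proof.
move=> fs; elim: s N => [N NS|x s IH N /= [Nx b]].
  apply: lsub_ext => y; have [x <-] := fs y.
  by rewrite -[N _]/(preS N x) NS.
by split=> //; apply: IH; rewrite preS_adjS.
Qed.

End Transport.

Section Dimension.
Variables (K : fieldType) (M : lmodType K).

Lemma has_dim_span n (e : 'I_n -> M) :
  (forall v, exists! c : 'I_n -> K, v = \sum_i c i *: e i) ->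
  foldl (@adjS K M) (zeroS M) (codom e) = fullS M.
Proof.
move=> he; apply: lsub_ext => v; split=> // _.
have [c [-> _]] := he v.
elim/big_ind: _ => [|x y|i _]; [exact: sub0S|exact: subDS|].
by apply: subZS; apply: foldl_adjS_in; exact: codom_f.
Qed.

Lemma finite_dim_basis : finite_dim M -> exists s, basis_mod (zeroS M) (fullS M) s.
Proof.
move=> [n [e /has_dim_span <-]].
by have [t _ tb] := foldl_adjS_basis (zeroS M) (codom e); exists t.
Qed.

Lemma basis_has_coord s : basis_mod (zeroS M) (fullS M) s ->
  forall v, exists! c : 'I_(size s) -> K, v = \sum_i c i *: s`_i.
Proof.
move=> b v; have [c [cv cu]] := basis_mod_coord b (I : fullS M v).
exists c; split=> [|c' vE]; first by apply/eqP; rewrite -subr_eq0; apply/eqP.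
by apply: cu; rewrite /= {1}vE subrr.
Qed.

End Dimension.

(** * Monomials of the exterior algebra *)

Section Line.
Variables (K : fieldType) (P : lmodType K).

Lemma lineP (p v : P) : adjS (zeroS P) p v <-> exists c, v = c *: p.
Proof.
split=> -[c]; first by move=> /subr0_eq ->; exists c.
by move=> ->; exists c; rewrite /= subrr.
Qed.

End Line.

Section Monomials.
Variables (K : fieldType) (M : lmodType K).
Implicit Types (u v : ext M) (x y : M) (s t w : seq M) (N S : lsubspace M).

Lemma wedge_linear u : linear (wedge u).
Proof. by move=> a v v'; rewrite /wedge tensorPr linearP. Qed.
HB.instance Definition _ u := GRing.isLinear.Build K (ext M) (ext M) _
  (wedge u) (wedge_linear u).

Definition wedger v u := wedge u v.
Lemma wedger_linear v : linear (wedger v).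
Proof. by move=> a u u'; rewrite /wedger /wedge tensorPl linearP. Qed.
HB.instance Definition _ v := GRing.isLinear.Build K (ext M) (ext M) _
  (wedger v) (wedger_linear v).

Lemma spanS_ind (P : lmodType K) (A : set P) (Q : lsubspace P) (u : P) :
  A `<=` Q -> spanS A u -> Q u.
Proof. by move=> AQ /(_ Q AQ)/set_mem. Qed.

Lemma ext_mon0 s t : ext_mon (s ++ 0 :: t) = 0.
Proof.
by have := ext_mon_lin s t (-1) 0 0; rewrite scaler0 addr0 scaleN1r addNr.
Qed.

Lemma ext_mon_swap s t x y :
  ext_mon (s ++ [:: x, y & t]) = - ext_mon (s ++ [:: y, x & t]).
Proof.
apply/eqP; rewrite -addr_eq0; apply/eqP.
have E z := ext_mon_lin (rcons s z) t 1 x y; move: E.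
have := ext_mon_alt s t (1 *: x + y); rewrite ext_mon_lin => + E.
rewrite -!(cat_rcons _ _ (_ + _ :: _)) !E !cat_rcons !ext_mon_alt !scale1r.
by rewrite add0r addr0.
Qed.

Lemma ext_mon_move s t r x :
  ext_mon (s ++ x :: t ++ r) = (-1) ^+ size t *: ext_mon (s ++ t ++ x :: r).
Proof.
elim: t s => [|y t IH] s /=; first by rewrite scale1r.
by rewrite ext_mon_swap -cat_rcons IH cat_rcons exprS mulN1r scaleNr.
Qed.

Lemma ext_mon_swap_cat s t r w :
  ext_mon (s ++ t ++ r ++ w) =
    (-1) ^+ (size t * size r) *: ext_mon (s ++ r ++ t ++ w).
Proof.
elim: t s => [|x t IH] s /=; first by rewrite scale1r.
by rewrite -cat_rcons IH cat_rcons ext_mon_move scalerA -exprD mulSn addnC.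
Qed.

(** For a linear map phi: phi factors through the exterior algebra of M / N. *)
Definition kills (P : lmodType K) (phi : ext M -> P) N :=
  forall s t x, N x -> phi (ext_mon (s ++ x :: t)) = 0.

Lemma kills_congr (P : lmodType K) (phi : {linear ext M -> P}) N
    (T : eqType) (f g : T -> M) (w : seq T) s t :
    kills phi N -> (forall i, i \in w -> N (f i - g i)) ->
  phi (ext_mon (s ++ map f w ++ t)) = phi (ext_mon (s ++ map g w ++ t)).
Proof.
move=> kN; elim: w s => [//|i w IH] s h /=.
have Ni : N (f i - g i) by apply: h; rewrite mem_head.
rewrite -[in LHS](subrK (g i) (f i)) -[f i - g i]scale1r ext_mon_lin linearP.
rewrite (kN s _ _ Ni) scaler0 add0r -!cat_rcons IH// => j jw.
by apply: h; rewrite in_cons jw orbT.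
Qed.

Lemma kills_line x : kills (wedger (ext_mon [:: x])) (adjS (zeroS M) x).
Proof.
move=> s t _ /lineP[c ->]; rewrite /wedger wedgeE -[c *: x]addr0.
rewrite -catA cat_cons ext_mon_lin ext_mon0 addr0 ext_mon_move.
by have := ext_mon_alt (s ++ t) [::] x; rewrite -catA => ->; rewrite !scaler0.
Qed.

(** A vector of the span of S and x may be replaced by one of S wherever x is
    another factor; without such a factor, x comes out by linearity. *)
Lemma ext_mon_adjS (Q : lsubspace (ext M)) S x s w :
    (forall t, (forall y, y \in t -> S y) -> size t = size (s ++ w) ->
       Q (ext_mon t)) ->
    (forall t, (forall y, y \in t -> S y) -> (size t).+1 = size (s ++ w) ->
       Q (ext_mon (rcons t x))) ->
    (forall y, y \in s -> S y) -> (forall y, y \in w -> adjS S x y) ->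
  Q (ext_mon (s ++ w)).
Proof.
move=> Q1 Q2; elim: w s Q1 Q2 => [|y w IH] s Q1 Q2 hs hw.
  by rewrite cats0 in Q1 *; exact: Q1.
have [c Sy] : adjS S x y by apply: hw; rewrite mem_head.
have hw' z : z \in w -> adjS S x z by move=> zw; apply: hw; rewrite in_cons zw orbT.
rewrite -(subrK (c *: x) y) addrC ext_mon_lin; apply: subPS; last first.
  have sz z : size (rcons s z ++ w) = size (s ++ y :: w).
    by rewrite cat_rcons !size_cat.
  rewrite -cat_rcons; apply: IH; rewrite ?sz// => z.
  by rewrite mem_rcons in_cons => /predU1P[->|/hs].
have /choice[f fE] : forall z, exists z', adjS S x z ->
    S z' /\ adjS (zeroS M) x (z - z').
  move=> z; have [[d Sd]|//] := pselect (adjS S x z); last by exists 0.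
  exists (z - d *: x) => _; split=> //; apply/lineP; exists d.
  by rewrite opprB addrC subrK.
have := @ext_mon_move s w [::] x; rewrite cats0 => ->; apply: subZS.
have := @kills_congr _ (wedger (ext_mon [:: x])) _ _ id f w s [::] (@kills_line x).
rewrite map_id !cats0 /= /wedger !wedgeE -!catA => ->; last by move=> z /hw'/fE[].
rewrite catA cats1; apply: Q2; last by rewrite !size_cat size_map /= addnS.
by move=> z; rewrite mem_cat => /orP[/hs//|/mapP[z' /hw'/fE[? _] ->]].
Qed.

(** A list that spans M modulo N has the largest size for which monomials do not
    all vanish modulo N, and in this degree its monomial spans all of them. Maps
    that vanish on N are used so that several exterior algebras can be compared
    with one and the same scalar. *)
Lemma kills_span (P : lmodType K) (phi : {linear ext M -> P}) N s w :
    kills phi N -> (forall y, y \in w -> foldl (@adjS K M) N s y) ->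
  ((size s < size w)%N -> phi (ext_mon w) = 0) /\
  (size w = size s -> exists c, phi (ext_mon w) = c *: phi (ext_mon s)).
Proof.
elim/last_ind: s phi w => [|s x IH] phi w kN hw.
  split=> [|/size0nil ->]; last by exists 1; rewrite scale1r.
  by case: w hw => [//|y w] hw _; apply: (kN [::]); apply: hw; rewrite mem_head.
rewrite size_rcons.
pose S := foldl (@adjS K M) N s.
pose psi : {linear ext M -> P} := phi \o wedger (ext_mon [:: x]).
have psiE t : psi (ext_mon t) = phi (ext_mon (rcons t x)).
  by rewrite /psi /= /wedger wedgeE cats1.
have kpsi : kills psi N by move=> t t' n Nn; rewrite psiE rcons_cat; exact: kN.
have {}hw y : y \in w -> adjS S x y by move=> /hw; rewrite foldl_rcons.
split=> sw.
- apply: (@ext_mon_adjS (preS phi (zeroS P)) S x [::] w) => //= t ht st.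
  + by have [+ _] := IH phi t kN ht; apply; rewrite st (ltn_trans _ sw).
  + have [+ _] := IH psi t kpsi ht; rewrite psiE; apply.
    by rewrite -ltnS st.
- apply/lineP.
  apply: (@ext_mon_adjS (preS phi (adjS (zeroS P) (phi (ext_mon (rcons s x))))) S x
    [::] w) => //= t ht st.
  + have [+ _] := IH phi t kN ht; rewrite st sw => /(_ (ltnSn _)) ->.
    exact: (sub0S (adjS (zeroS P) _)).
  + have [_] := IH psi t kpsi ht; rewrite !psiE => /(_ _)/lineP; apply.
    by move: st; rewrite sw => -[].
Qed.

Lemma kills_ext_pow (P : lmodType K) (phi : {linear ext M -> P}) N s u :
    kills phi N -> basis_mod N (fullS M) s -> ext_pow M (size s) u ->
  exists c, phi u = c *: phi (ext_mon s).
Proof.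
move=> kN /basis_mod_span sE hu; apply/lineP.
apply: (spanS_ind (Q := preS phi (adjS (zeroS P) (phi (ext_mon s)))) _ hu).
move=> _ [w /= sw <-]; apply/lineP.
by apply: (kills_span (w := w) kN _).2 => // y _; rewrite sE.
Qed.

Lemma kills_zero (P : lmodType K) (phi : {linear ext M -> P}) : kills phi (zeroS M).
Proof.
by move=> s t _ ->; rewrite ext_mon0 linear0.
Qed.

(** With one more vector of N, the basis s of N becomes a list of vectors of N
    that is longer than a spanning list. *)
Lemma kills_wedge N s : basis_mod (zeroS M) N s -> kills (wedge (ext_mon s)) N.
Proof.
move=> b w t x Nx; rewrite wedgeE.
rewrite (ext_mon_swap_cat s w [:: x] t) catA -wedgeE.
have sN y : y \in s ++ [:: x] -> foldl (@adjS K M) (zeroS M) s y.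
  rewrite (basis_mod_span b) mem_cat mem_seq1 => /orP[|/eqP->//].
  exact: basis_mod_in b.
have [+ _] := kills_span (phi := idfun) (@kills_zero _ idfun) sN.
rewrite size_cat addn1 => /(_ (ltnSn _)) /= ->.
by rewrite -/(wedger _ _) linear0 scaler0.
Qed.

End Monomials.

(** * Degrees and determinant lines *)

Section Degrees.
Variables (K : fieldType) (M : lmodType K).
Implicit Types (u : ext M) (s t : seq M).

Lemma ext_pow_mon k s : size s = k -> ext_pow M k (ext_mon s).
Proof. by move=> sk; apply: sub_spanS; exists s. Qed.

Lemma ext_pow_wedge j k u (v : ext M) :
  ext_pow M j u -> ext_pow M k v -> ext_pow M (j + k) (wedge u v).
Proof.
move=> ju kv.
apply: (spanS_ind (Q := preS (wedger v) (ext_pow M (j + k))) _ ju).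
move=> _ [s /= sj <-].
apply: (spanS_ind (Q := preS (wedge (ext_mon s)) (ext_pow M (j + k))) _ kv).
move=> _ [t /= tk <-]; rewrite /lsub_mem /= wedgeE; apply: ext_pow_mon.
by rewrite size_cat sj tk.
Qed.

(** The projection onto the component of degree k. *)
Lemma exists_ext_proj k : exists p : {linear ext M -> ext M},
  forall s, p (ext_mon s) = if size s == k then ext_mon s else 0.
Proof.
apply: (ext_univ (g := fun s => if size s == k then ext_mon s else 0)).
  move=> s t a x y; rewrite !size_cat/=; case: ifP => _; last by rewrite scaler0 addr0.
  exact: ext_mon_lin.
by move=> s t x; rewrite ext_mon_alt if_same.
Qed.

Lemma ext_pow_inj j k u : ext_pow M j u -> ext_pow M k u -> u != 0 -> j = k.
Proof.
move=> ju ku; apply: contraNeq => jk; have [p pE] := exists_ext_proj k.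
have p1 : p u = u.
  apply/eqP; rewrite -subr_eq0; apply/eqP.
  pose q : {linear ext M -> ext M} := p \- idfun.
  apply: (spanS_ind (Q := preS q (zeroS _)) _ ku) => _ [s /= sk <-].
  by rewrite /lsub_mem /= pE sk eqxx subrr.
rewrite -p1; apply/eqP.
apply: (spanS_ind (Q := preS p (zeroS _)) _ ju) => _ [s /= sj <-].
by rewrite /lsub_mem /= pE sj (negPf jk).
Qed.

(** The determinant of the coordinates is an alternating form that does not
    vanish on the basis. *)
Lemma ext_mon_neq0 n (e : 'I_n -> M) :
  (forall v, exists! c : 'I_n -> K, v = \sum_i c i *: e i) ->
  ext_mon (codom e) != 0.
Proof.
move=> he; have /choice[c cE] : forall v, exists c : 'I_n -> K,
    v = \sum_i c i *: e i /\ forall c', v = \sum_i c' i *: e i -> c = c'.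
  by move=> v; have [d [vd du]] := he v; exists d.
have clin a x y j : c (a *: x + y) j = a * c x j + c y j.
  rewrite (proj2 (cE (a *: x + y)) (fun i => a * c x i + c y i))//.
  rewrite {1}(proj1 (cE x)) {1}(proj1 (cE y)) scaler_sumr -big_split/=.
  by apply: eq_bigr => i _; rewrite scalerA scalerDl.
have ce i j : c (e i) j = (i == j)%:R.
  rewrite (proj2 (cE (e i)) (fun j => (i == j)%:R))//.
  rewrite (bigD1 i)//= eqxx scale1r big1 ?addr0// => k ki.
  by rewrite eq_sym (negPf ki) scale0r.
pose A s : 'M[K]_n := \matrix_(i < n, j < n) c s`_i j.
pose g s : K^o := if size s == n then \det (A s) else 0.
have [||f fE] := @ext_univ K M K^o g.
- move=> s t a x y; rewrite /g !size_cat/=; case: eqP => [sn|_]; last first.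
    by rewrite scaler0 addr0.
  have sn' : (size s < n)%N by rewrite -sn addnS ltnS leq_addr.
  rewrite -[RHS]/(a * \det _ + \det _) -[\det (A (s ++ y :: t))]mul1r.
  have nE (z : M) : (s ++ z :: t)`_(Ordinal sn') = z by rewrite nth_cat ltnn subnn.
  have rE (z z' : M) :
      row' (Ordinal sn') (A (s ++ z :: t)) = row' (Ordinal sn') (A (s ++ z' :: t)).
    apply/matrixP => i j; rewrite !mxE !nth_cat.
    have := neq_lift (Ordinal sn') i; rewrite -val_eqE/= => ne.
    case: ltnP => // le; case E : (bump _ _ - _)%N => [|m]//.
    by move: ne; rewrite eqn_leq le -subn_eq0 E.
  apply: (determinant_multilinear (i0 := Ordinal sn')); [|exact: rE|exact: rE].
  by apply/rowP => j; rewrite !mxE !nE clin mul1r.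
- move=> s t x; rewrite /g size_cat/=; case: eqP => // sn.
  have s0 : (size s < n)%N by rewrite -sn addnS ltnS leq_addr.
  have s1 : ((size s).+1 < n)%N by rewrite -sn !addnS !ltnS leq_addr.
  apply: (determinant_alternate (i1 := Ordinal s0) (i2 := Ordinal s1)).
    by rewrite -val_eqE/= ltn_eqF.
  by move=> j; rewrite !mxE !nth_cat/= ltnn subnn ltnNge leqnSn/= subSnn.
apply: contra_eq_neq (fE (codom e)) => ->.
rewrite linear0 /g size_codom card_ord eqxx eq_sym.
suff -> : A (codom e) = 1%:M by rewrite det1 oner_eq0.
apply/matrixP => i j; rewrite !mxE -ce; congr (c _ j).
by rewrite codomE (nth_map i) ?size_enum_ord// nth_ord_enum.
Qed.

(** A monomial longer than a spanning list vanishes, that of a basis does not. *)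
Lemma has_dim_leq m n : has_dim M m -> has_dim M n -> (m <= n)%N.
Proof.
move=> [e he] [e' he']; rewrite leqNgt; apply: contraT => /negPn nm.
have := ext_mon_neq0 he; apply: contraNT => _.
have sN y : y \in codom e -> foldl (@adjS K M) (zeroS M) (codom e') y.
  by rewrite (has_dim_span he').
have [+ _] := kills_span (phi := idfun) (@kills_zero _ _ _ idfun) sN.
by rewrite !size_codom !card_ord => /(_ nm) /= ->.
Qed.

Lemma codom_nth s : codom (fun i : 'I_(size s) => s`_i) = s.
Proof. by rewrite codomE map_comp val_enum_ord -/(mkseq _ _) mkseq_nth. Qed.

Lemma basis_neq0 s : basis_mod (zeroS M) (fullS M) s -> ext_mon s != 0.
Proof.
by move=> b; rewrite -[s]codom_nth; apply: ext_mon_neq0; exact: basis_has_coord.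
Qed.

Lemma dim_basis s : basis_mod (zeroS M) (fullS M) s -> Defs.dim M = size s.
Proof.
move=> b; have hs : has_dim M (size s).
  by exists (fun i : 'I_(size s) => s`_i); exact: basis_has_coord.
have hd : has_dim M (Defs.dim M) by apply: (getPex (P := [set n | has_dim M n])); exists (size s).
by apply/eqP; rewrite eqn_leq !has_dim_leq.
Qed.

Lemma det_pow (g : Det M) : ext_pow M (Defs.dim M) (lsub_val g).
Proof. by have /set_mem := valP g. Qed.

Lemma basis_det s : basis_mod (zeroS M) (fullS M) s ->
  exists g : Det M, det_gen (ext_mon s) g.
Proof.
move=> b; have ds := dim_basis b.
have h : ext_mon s \in lsubspace_pred (ext_pow M (Defs.dim M)).
  by apply: mem_set; apply: ext_pow_mon.
exists (LSub h); split=> //; split.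
  by have := basis_neq0 b; apply: contra_neq => /(congr1 (@lsub_val _ _ _)).
move=> y; have hy : ext_pow M (size s) (lsub_val y) by rewrite -ds; exact: det_pow.
have [c yE] := kills_ext_pow (phi := idfun) (@kills_zero _ _ _ idfun) b hy.
by exists c; apply: val_inj.
Qed.

End Degrees.

Section Lines.
Variables (K : fieldType).
Implicit Types (L P : lmodType K).

Lemma tensorZl L P a (x : L) (p : P) : (a *: x) ⊗ p = a *: (x ⊗ p).
Proof.
have e0 : (0 : L) ⊗ p = 0.
  by have := tensorPl (-1) (0 : L) 0 p; rewrite scaler0 addr0 scaleN1r addNr.
by rewrite -[a *: x]addr0 tensorPl e0 addr0.
Qed.

Lemma tensorZr L P a (x : L) (p : P) : x ⊗ (a *: p) = a *: (x ⊗ p).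
Proof.
have e0 : x ⊗ (0 : P) = 0.
  by have := tensorPr (-1) x (0 : P) 0; rewrite scaler0 addr0 scaleN1r addNr.
by rewrite -[a *: p]addr0 tensorPr e0 addr0.
Qed.

Lemma generator_lin L P (x : L) (p : P) : generator x ->
  exists f : {linear L -> P}, f x = p.
Proof.
move=> [x0 /choice[c cE]].
have inj a b : a *: x = b *: x -> a = b.
  move=> /eqP; rewrite -subr_eq0 -scalerBl => h; apply/eqP; rewrite -subr_eq0.
  by move: h; apply: contraLR => h; rewrite scaler_eq0 negb_or h.
have /mk_linear[f fE] : linear (fun y => c y *: p).
  move=> a y z; rewrite scalerA -scalerDl; congr (_ *: _); apply: inj.
  by rewrite -cE scalerDl -scalerA -!cE.
exists f; rewrite fE (_ : c x = 1) ?scale1r//.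
by apply: inj; rewrite -cE scale1r.
Qed.

(** The product of the coordinates is a bilinear form with value 1 at (x, p), and
    every pure tensor vanishes modulo the line of x ⊗ p. *)
Lemma generator_tensor L P (x : L) (p : P) :
  generator x -> generator p -> generator (x ⊗ p).
Proof.
move=> gx gp; split.
  have [f fx] := @generator_lin L K^o x 1 gx.
  have [g gpE] := @generator_lin P K^o p 1 gp.
  have [||h hE] := @tens_univ K L P K^o (fun y q => f y * g q : K^o).
  - by move=> q a y z; rewrite linearP mulrDl -scalerAl.
  - by move=> y a q r; rewrite linearP mulrDr -scalerAr.
  apply: contra_eq_neq (hE x p) => ->.
  by rewrite linear0 fx gpE mulr1 eq_sym oner_eq0.
pose N := adjS (zeroS (tens L P)) (x ⊗ p).
suff NE t : N t by move=> t; apply/lineP; exact: NE.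
pose z : {linear tens L P -> lquot N} := \0.
have /eqP : lproj N t = z t.
  apply: tens_ext => y q.
  have [_ /(_ y)[a ->]] := gx; have [_ /(_ q)[b ->]] := gp.
  apply/eqP; rewrite -[z _]/(0 : lquot N) -(linear0 (lproj N)) [_ == _]lproj_eqE subr0.
  apply/mem_set/lineP; exists (a * b).
  by rewrite tensorZl tensorZr scalerA.
by rewrite -[z t]/(0 : lquot N) -(linear0 (lproj N)) [_ == _]lproj_eqE subr0 => /set_mem.
Qed.

Lemma dual_lin L (f : dual L) a x y :
  lsub_val f (a *: x + y) = a * lsub_val f x + lsub_val f y.
Proof. by have /set_mem/(_ a x y) := valP f. Qed.

Lemma dual_linZ L (f : dual L) a x : lsub_val f (a *: x) = a * lsub_val f x.
Proof.
have f0 : lsub_val f 0 = 0.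
  by have := dual_lin f (-1) 0 0; rewrite scaler0 addr0 mulN1r addNr.
by rewrite -[_ *: _]addr0 dual_lin f0 addr0.
Qed.

Lemma dual_genE L (x : L) : generator x -> lsub_val (dual_gen x) x = 1.
Proof.
move=> gx; apply: (@xgetPex _ 0 [set f : dual L | lsub_val f x = 1]).
have [f fx] := @generator_lin L K^o x 1 gx.
have h : (f : L -> K^o) \in lsubspace_pred (LSubspace (@dual_closed K L)).
  by apply: mem_set => a y z; rewrite linearP.
by exists (LSub h).
Qed.

Lemma dual_ext L (x : L) (f g : dual L) : generator x ->
  lsub_val f x = lsub_val g x -> f = g.
Proof.
move=> [_ gx] fg; apply/val_inj/funext => y; have [a ->] := gx y.
by rewrite /= !dual_linZ fg.
Qed.

Lemma dual_generator L (x : L) : generator x -> generator (dual_gen x).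
Proof.
move=> gx; split.
  apply: contra_eq_neq (dual_genE gx) => ->.
  by rewrite eq_sym oner_eq0.
move=> f; exists (lsub_val f x); apply: (dual_ext gx).
by rewrite -[RHS]/(lsub_val f x * lsub_val (dual_gen x) x) dual_genE// mulr1.
Qed.

Lemma dual_genZ L (x : L) a : generator x -> a != 0 ->
  dual_gen (a *: x) = a^-1 *: dual_gen x.
Proof.
move=> gx a0; have gax : generator (a *: x).
  case: gx => x0 gx; split; first by rewrite scaler_eq0 negb_or a0.
  by move=> y; have [b ->] := gx y; exists (b / a); rewrite scalerA divfK.
apply: (dual_ext gax); rewrite dual_genE//.
rewrite -[RHS]/(a^-1 * lsub_val (dual_gen x) (a *: x)) dual_linZ dual_genE//.
by rewrite mulr1 mulVf.
Qed.

End Lines.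

(** * The isomorphism S(X,(V,W)) in adapted bases *)

Section Lifts.
Variables (K : fieldType) (H : lmodType K).
Implicit Types (X V W N : lsubspace H) (h : H) (s : seq H).

(** Zero outside V; this makes lists of vectors of H the common source of the
    lists of all the subspaces. *)
Definition lift V h : lsub_of V := insubd 0 h.

Lemma lift_val V h : V h -> lsub_val (lift V h) = h.
Proof. by move=> Vh; apply: insubdK; exact: mem_set. Qed.

Lemma liftE V h (v : lsub_of V) : lsub_val v = h -> lift V h = v.
Proof.
move=> <-; apply: val_inj; apply: lift_val.
by have /set_mem := valP v.
Qed.

Lemma lsub_valP V (v : lsub_of V) : V (lsub_val v).
Proof. by have /set_mem := valP v. Qed.

Lemma preS_val_zero V : preS (@lsub_val K H V) (zeroS H) = zeroS (lsub_of V).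
Proof.
by apply: lsub_ext => v; split=> [v0|->]; [exact: val_inj|].
Qed.

Lemma preS_val_full V N : (forall h, V h -> N h) ->
  preS (@lsub_val K H V) N = fullS (lsub_of V).
Proof. by move=> VN; apply: lsub_ext => v; split=> // _; apply: VN; exact: lsub_valP. Qed.

Lemma basis_lift V N S s : (forall h, h \in s -> V h) -> basis_mod N S s ->
  basis_mod (preS (@lsub_val K H V) N) (preS (@lsub_val K H V) S) (map (lift V) s).
Proof.
move=> sV b; apply: basis_mod_pre; rewrite -map_comp map_id_in// => h /sV.
exact: lift_val.
Qed.

Lemma basis_lift_full V s : basis_mod (zeroS H) V s ->
  basis_mod (zeroS _) (fullS _) (map (lift V) s).
Proof.
move=> b; have := basis_lift (V := V) (fun h => basis_mod_in b) b.
by rewrite preS_val_zero preS_val_full.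
Qed.

Lemma lproj_eq0 N h : lproj N h = 0 <-> N h.
Proof.
rewrite -(linear0 (lproj N)); split=> [/eqP|Nh].
  by rewrite [_ == _]lproj_eqE subr0 => /set_mem.
by apply/eqP; rewrite [_ == _]lproj_eqE subr0; apply: mem_set.
Qed.

Lemma preS_lproj_zero N : preS (lproj N) (zeroS _) = N.
Proof. by apply: lsub_ext => h; exact: lproj_eq0. Qed.

Lemma lproj_onto N (q : lquot N) : exists h, lproj N h = q.
Proof. by have [h ->] := lproj_surj q; exists h. Qed.

Lemma basis_lproj N S S' s : preS (lproj N) S' = S -> basis_mod N S s ->
  basis_mod (zeroS _) S' (map (lproj N) s).
Proof.
move=> <- b; apply: basis_mod_im; first exact: lproj_onto.
by rewrite preS_lproj_zero.
Qed.

Lemma basis_lproj_full N s : basis_mod N (fullS H) s ->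
  basis_mod (zeroS _) (fullS _) (map (lproj N) s).
Proof. by move=> b; apply: basis_lproj b; apply: lsub_ext. Qed.

Lemma linclE V W (v : lsub_of V) : (forall h, V h -> W h) ->
  lsub_val (lincl V W v) = lsub_val v.
Proof.
move=> VW.
have E (u : lsub_of V) : lsub_val (lift W (lsub_val u)) = lsub_val u.
  by rewrite lift_val//; apply: VW; exact: lsub_valP.
have /mk_linear[f fE] : linear (fun u : lsub_of V => lift W (lsub_val u)).
  move=> c u w; apply: val_inj.
  by rewrite [LHS]E linearP -[RHS]/(c *: _ + _) [in RHS]/= [in RHS]E [in RHS]E.
apply: (getPex (P := [set f : {linear lsub_of V -> lsub_of W} |
  forall v, f v = v :> H])).
by exists f => u; rewrite fE E.
Qed.

Lemma addS_subl V W h : V h -> addS V W h.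
Proof. by move=> Vh; exists h => //; exists 0; [exact: sub0S|rewrite addr0]. Qed.

Lemma addS_subr V W h : W h -> addS V W h.
Proof. by move=> Wh; exists 0; [exact: sub0S|exists h => //; rewrite add0r]. Qed.

(** Bases adapted to the exact sequence of S(X,(V,W)), as lists of vectors of H:
    p b is the image of b under T2, and the monomials of a, b, c and d serve as
    a1, a2, a3 and a4. *)
Record flag X V W (p : H -> H) (a b c d : seq H) : Prop := Flag {
  flag_disj : forall h, X h -> V h -> h = 0;
  flag_proj : forall h, addS X V h -> X (p h) /\ V (h - p h);
  flag1 : basis_mod (zeroS H) (capS V W) a;
  flag2 : basis_mod (capS V W) (capS (addS X V) W) b;
  flag3 : basis_mod (addS V W) (addS (addS X V) W) c;
  flag_in : forall h, h \in c -> X h;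
  flag4 : basis_mod (addS (addS X V) W) (fullS H) d }.

End Lifts.

Section Flag.
Variables (K : fieldType) (H : lmodType K) (X V W : lsubspace H) (p : H -> H).
Variables (a b c d : seq H).
Hypothesis F : flag X V W p a b c d.

Lemma flag_capXV : capS V X = zeroS H.
Proof.
apply: lsub_ext => h; split=> [[Vh Xh]|->]; first exact: (flag_disj F).
exact: (sub0S (capS V X)).
Qed.

Lemma flag_b_in h : h \in b -> capS (addS X V) W h.
Proof. exact: basis_mod_in (flag2 F). Qed.

(** The image of T2 is the kernel X ∩ (V + W) of T3; modulo V, its basis p b is
    the basis b of ((X + V) ∩ W) / (V ∩ W). *)
Lemma flag_basis_ker3 : basis_mod (zeroS H) (capS (addS V W) X) (map p b).
Proof.
have := basis_mod_add (W := W) (fun h hb => proj2 (flag_b_in hb)) (flag2 F).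
have pV h : h \in b -> V (h - p h) by move=> /flag_b_in[/(flag_proj F)[]].
have pX h : h \in map p b -> X h.
  by move=> /mapP[h' /flag_b_in[/(flag_proj F)[Xp _] _] ->].
move=> /(basis_mod_congr pV)/(basis_mod_cap pX).
rewrite flag_capXV; congr basis_mod; apply: lsub_ext => h; split.
  by move=> [[v Vv [w [_ Ww] <-]] Xh]; split=> //; exists v => //; exists w.
move=> [[v Vv [w Ww e]] Xh]; split=> //; exists v => //; exists w => //.
split=> //; exists h => //; exists (- v); first exact: subNS.
by rewrite -e addrC addKr.
Qed.

Lemma flag_basis_X3 : basis_mod (capS (addS V W) X) X c.
Proof.
have := basis_mod_cap (@flag_in _ _ _ _ _ _ _ _ _ _ F) (flag3 F).
congr basis_mod; apply: lsub_ext => h; split=> [[]//|Xh]; split=> //.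
by apply: addS_subl; exact: addS_subl.
Qed.

Lemma flag_basis1 : basis_mod (zeroS _) (fullS _) (map (lift (capS V W)) a).
Proof. exact: basis_lift_full (flag1 F). Qed.

Lemma flag_basis2 :
  basis_mod (zeroS _) (fullS _) (map (lift (capS (addS X V) W)) (a ++ b)).
Proof. exact: basis_lift_full (basis_mod_cat (flag1 F) (flag2 F)). Qed.

Lemma flag_basis3 : basis_mod (zeroS _) (fullS _) (map (lift X) (map p b ++ c)).
Proof. exact: basis_lift_full (basis_mod_cat flag_basis_ker3 flag_basis_X3). Qed.

Lemma flag_basis4 :
  basis_mod (zeroS _) (fullS _) (map (lproj (addS V W)) (c ++ d)).
Proof. exact: basis_lproj_full (basis_mod_cat (flag3 F) (flag4 F)). Qed.

Lemma flag_basis5 :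
  basis_mod (zeroS _) (fullS _) (map (lproj (addS (addS X V) W)) d).
Proof. exact: basis_lproj_full (flag4 F). Qed.

Lemma seqT1E h : capS V W h ->
  seqT1 X V W (lift (capS V W) h) = lift (capS (addS X V) W) h.
Proof.
move=> Vh; apply/esym/liftE; rewrite linclE ?lift_val// => h' [Vh' Wh'].
by split=> //; exact: addS_subr.
Qed.

Lemma seqT2E u (x : lsub_of X) (v : lsub_of V) :
  lsub_val u = lsub_val x + lsub_val v -> seqT2 X V W u = x.
Proof.
have pE (w : lsub_of (capS (addS X V) W)) (y : lsub_of X) (z : lsub_of V) :
    lsub_val w = lsub_val y + lsub_val z -> lift X (p (lsub_val w)) = y.
  move=> e; apply: liftE; apply/eqP; rewrite -subr_eq0; apply/eqP.
  have [Xp Vp] : X (p (lsub_val w)) /\ V (lsub_val w - p (lsub_val w)).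
    by apply: (flag_proj F); have [] := lsub_valP w.
  apply: (flag_disj F); first by apply: subBS => //; exact: lsub_valP.
  have -> : lsub_val y - p (lsub_val w) = lsub_val w - p (lsub_val w) - lsub_val z.
    by rewrite e addrAC addrK.
  by apply: subBS => //; exact: lsub_valP.
have ex (w : lsub_of (capS (addS X V) W)) :
    exists yz : lsub_of X * lsub_of V, lsub_val w = lsub_val yz.1 + lsub_val yz.2.
  have [[y Xy [z Vz e]] _] := lsub_valP w.
  by exists (lift X y, lift V z); rewrite /= !lift_val.
have /mk_linear[f fE] : linear (fun w : lsub_of (capS (addS X V) W) =>
    lift X (p (lsub_val w))).
  move=> k w w'; have [[y z] e] := ex w; have [[y' z'] e'] := ex w'.
  rewrite (pE _ _ _ e) (pE _ _ _ e'); apply: (pE _ _ (k *: z + z')).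
  by rewrite /= e e' scalerDr addrACA.
apply: (getPex (P := [set f : {linear lsub_of (capS (addS X V) W) -> lsub_of X} |
  forall u (x : lsub_of X) (v : lsub_of V),
    lsub_val u = lsub_val x + lsub_val v -> f u = x])).
by exists f => w y z e; rewrite fE; exact: pE e.
Qed.

Lemma seqT2_lift h : capS (addS X V) W h ->
  seqT2 X V W (lift (capS (addS X V) W) h) = lift X (p h).
Proof.
move=> hh; have [Xp Vp] := flag_proj F (proj1 hh).
by apply: (@seqT2E _ _ (lift V (h - p h))); rewrite !lift_val// addrC subrK.
Qed.

Lemma seqT3E h : X h -> seqT3 X V W (lift X h) = lproj (addS V W) h.
Proof. by move=> Xh; rewrite /seqT3 /= lift_val. Qed.

Lemma seqT4E h : seqT4 X V W (lproj (addS V W) h) = lproj (addS (addS X V) W) h.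
Proof.
have [h' /set_mem[v Vv [w Ww <-]]|f fE] :=
    lquot_univ (N := addS V W) (f := lproj (addS (addS X V) W)).
  apply/lproj_eq0; exists v; [exact: addS_subr|by exists w].
apply: (getPex (P := [set f : {linear coker V W -> coker (addS X V) W} |
  forall h, f (lproj (addS V W) h) = lproj (addS (addS X V) W) h])).
by exists f.
Qed.

Lemma map_seqT1 : map (seqT1 X V W) (map (lift (capS V W)) a) =
  map (lift (capS (addS X V) W)) a.
Proof.
rewrite -map_comp; apply/eq_in_map => h /(basis_mod_in (flag1 F)).
exact: seqT1E.
Qed.

Lemma map_seqT2 : map (seqT2 X V W) (map (lift (capS (addS X V) W)) b) =
  map (lift X) (map p b).
Proof.
by rewrite -!map_comp; apply/eq_in_map => h /flag_b_in; exact: seqT2_lift.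
Qed.

Lemma map_seqT3 : map (seqT3 X V W) (map (lift X) c) = map (lproj (addS V W)) c.
Proof.
by rewrite -map_comp; apply/eq_in_map => h /(flag_in F); exact: seqT3E.
Qed.

Lemma map_seqT4 : map (seqT4 X V W) (map (lproj (addS V W)) d) =
  map (lproj (addS (addS X V) W)) d.
Proof. by rewrite -map_comp; apply: eq_map => h; exact: seqT4E. Qed.

Variables (g1 : Det (lsub_of (capS V W))).
Variables (g2 : Det (lsub_of (capS (addS X V) W))) (g3 : Det (lsub_of X)).
Variables (g4 : Det (coker V W)) (g5 : Det (coker (addS X V) W)).
Hypothesis G1 : det_gen (ext_mon (map (lift (capS V W)) a)) g1.
Hypothesis G2 : det_gen (ext_mon (map (lift (capS (addS X V) W)) (a ++ b))) g2.
Hypothesis G3 : det_gen (ext_mon (map (lift X) (map p b ++ c))) g3.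
Hypothesis G4 : det_gen (ext_mon (map (lproj (addS V W)) (c ++ d))) g4.
Hypothesis G5 : det_gen (ext_mon (map (lproj (addS (addS X V) W)) d)) g5.

Lemma flag_adapted : adapted (ext_mon (map (lift (capS V W)) a))
  (ext_mon (map (lift (capS (addS X V) W)) b)) (ext_mon (map (lift X) c))
  (ext_mon (map (lproj (addS V W)) d)) g1 g2 g3 g4 g5.
Proof.
split; try by eexists; apply: mem_set; exact: ext_pow_mon.
- exact: G1.
- by rewrite ext_mapE wedgeE map_seqT1 -map_cat.
- by rewrite ext_mapE wedgeE map_seqT2 -map_cat.
- by rewrite ext_mapE wedgeE map_seqT3 -map_cat.
- by rewrite ext_mapE map_seqT4.
Qed.

End Flag.

Section Independence.
Variables (K : fieldType).

(** For an arrow U of an exact sequence and its kernel N. That A annihilates N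
    in the exterior algebra makes both A ∧ u and the image of u under U functions
    of the class of u modulo N, which lies on a line. *)
Lemma exact_step (B C : lmodType K) (U : {linear B -> C}) (N : lsubspace B)
    (A s : seq B) (t u : ext B) (e : K) (g g0 : Det B) :
    basis_mod (zeroS B) N A -> basis_mod N (fullS B) s ->
    (forall n, N n -> U n = 0) -> homogeneous u -> t = e *: ext_mon A ->
    det_gen (t ∧ u) g -> det_gen (ext_mon (A ++ s)) g0 ->
  exists k, [/\ k != 0, g = (e * k) *: g0 &
    ext_map U u = k *: ext_mon (map U s)].
Proof.
move=> bA bs UN [k /set_mem ku] tE [gE [g0' _]] [g0E _].
have uE : lsub_val g = e *: (ext_mon A ∧ u).
  by rewrite gE tE -/(wedger u _) linearZ.
have gn0 : lsub_val g != 0 by apply: contra_neq g0' => h; exact: val_inj.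
have kE : (size A + k = size A + size s)%N.
  apply: (@ext_pow_inj K B _ _ (lsub_val g)) => //.
    rewrite uE; apply: subZS; apply: ext_pow_wedge => //; exact: ext_pow_mon.
  by rewrite -size_cat -(dim_basis (basis_mod_cat bA bs)); exact: det_pow.
move/addnI: kE ku => -> ku.
have /mk_linear[phi phiE] : linear (fun u =>
    (ext_mon A ∧ u, ext_map U u) : ext B * ext C).
  by move=> x v w; rewrite !linearP.
have kphi : kills phi N.
  move=> s1 s2 n Nn; rewrite phiE (kills_wedge bA _ _ Nn).
  by rewrite ext_mapE map_cat /= UN// ext_mon0.
have [x] := kills_ext_pow kphi bs ku.
rewrite !phiE wedgeE ext_mapE => -[xA xU].
have gx : g = (e * x) *: g0.
  by apply: val_inj; rewrite /= uE xA scalerA g0E.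
exists x; split=> //; apply: contra_neq g0' => x0.
by rewrite gx x0 mulr0 scale0r.
Qed.

(** The scalars by which two choices of adapted elements differ cancel out. *)
Lemma rescaled_generators (L1 L2 L3 L4 L5 : lmodType K)
    (f : {linear tens L3 (tens L1 (dual L4)) -> tens L2 (dual L5)})
    (x1 : L1) (x2 : L2) (x3 : L3) (x4 : L4) (x5 : L5) (k1 k2 k3 k4 e : K) :
    generator x4 -> generator x5 -> k3 != 0 -> k4 != 0 ->
    f (x3 ⊗ (x1 ⊗ dual_gen x4)) = e *: (x2 ⊗ dual_gen x5) ->
  f (((k2 * k3) *: x3) ⊗ ((k1 *: x1) ⊗ dual_gen ((k3 * k4) *: x4))) =
    e *: (((k1 * k2) *: x2) ⊗ dual_gen (k4 *: x5)).
Proof.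
move=> gx4 gx5 k3n k4n fE; rewrite !dual_genZ ?mulf_neq0//.
rewrite !tensorZl !tensorZr !linearZ /= fE !scalerA; congr (_ *: _).
by field; rewrite k3n k4n.
Qed.

Variables (H : lmodType K) (X V W : lsubspace H) (p : H -> H).
Variables (a b c d : seq H).
Hypothesis F : flag X V W p a b c d.
Variables (g1 : Det (lsub_of (capS V W))).
Variables (g2 : Det (lsub_of (capS (addS X V) W))) (g3 : Det (lsub_of X)).
Variables (g4 : Det (coker V W)) (g5 : Det (coker (addS X V) W)).
Hypothesis G1 : det_gen (ext_mon (map (lift (capS V W)) a)) g1.
Hypothesis G2 : det_gen (ext_mon (map (lift (capS (addS X V) W)) (a ++ b))) g2.
Hypothesis G3 : det_gen (ext_mon (map (lift X) (map p b ++ c))) g3.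
Hypothesis G4 : det_gen (ext_mon (map (lproj (addS V W)) (c ++ d))) g4.
Hypothesis G5 : det_gen (ext_mon (map (lproj (addS (addS X V) W)) d)) g5.

(** Each a_i contributes one scalar, to the determinants of the two terms that it
    meets. *)
Lemma adapted_scalars u1 u2 u3 u4 h1 h2 h3 h4 h5 :
    @adapted _ _ X V W u1 u2 u3 u4 h1 h2 h3 h4 h5 ->
  exists k : K * K * K * K, let: (k1, k2, k3, k4) := k in
    [/\ k1 != 0, k2 != 0, k3 != 0 & k4 != 0] /\
    [/\ h1 = k1 *: g1, h2 = (k1 * k2) *: g2, h3 = (k2 * k3) *: g3,
        h4 = (k3 * k4) *: g4 & h5 = k4 *: g5].
Proof.
move=> [_ hom2 hom3 hom4 [E1 [h1n _]] gen2 gen3 gen4 [E5 _]].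
have [k1 hk1] := proj2 (proj2 G1) h1.
have k1n : k1 != 0 by apply: contra_neq h1n => k0; rewrite hk1 k0 scale0r.
have u1E : u1 = k1 *: ext_mon (map (lift (capS V W)) a).
  by rewrite -E1 hk1 -(proj1 G1).
have T1u : ext_map (seqT1 X V W) u1 =
    k1 *: ext_mon (map (lift (capS (addS X V) W)) a).
  by rewrite u1E linearZ /= ext_mapE (map_seqT1 F).
have sub2 h : capS V W h -> capS (addS X V) W h.
  by move=> [Vh Wh]; split=> //; exact: addS_subr.
pose N2 := preS (@lsub_val K H (capS (addS X V) W)) (capS V W).
have [||n||k2 [k2n h2E T2u]] := @exact_step _ _ (seqT2 X V W) N2
  (map (lift _) a) (map (lift _) b) _ _ _ _ g2 _ _ _ hom2 T1u gen2 _.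
- have := basis_lift (V := capS (addS X V) W)
    (fun h ha => sub2 h (basis_mod_in (flag1 F) ha)) (flag1 F).
  by rewrite preS_val_zero.
- have := basis_lift (fun h => @flag_b_in _ _ _ _ _ _ _ _ _ _ F h) (flag2 F).
  by rewrite [preS _ (capS (addS X V) W)]preS_val_full.
- move=> [Vn _]; apply: (seqT2E F (v := lift V (lsub_val n))).
  by rewrite lift_val// add0r.
- by rewrite -map_cat.
rewrite (map_seqT2 F) in T2u.
pose N3 := preS (@lsub_val K H X) (capS (addS V W) X).
have [||n||k3 [k3n h3E T3u]] := @exact_step _ _ (seqT3 X V W) N3
  (map (lift _) (map p b)) (map (lift _) c) _ _ _ _ g3 _ _ _ hom3 T2u gen3 _.
- have := basis_lift (V := X)
    (fun h ha => proj2 (basis_mod_in (flag_basis_ker3 F) ha)) (flag_basis_ker3 F).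
  by rewrite preS_val_zero.
- have := basis_lift (@flag_in _ _ _ _ _ _ _ _ _ _ F) (flag_basis_X3 F).
  by rewrite [preS _ X]preS_val_full.
- by move=> [VWn _]; apply/lproj_eq0.
- by rewrite -map_cat.
rewrite (map_seqT3 F) in T3u.
pose N4 := preS (seqT4 X V W) (zeroS _).
have N4E : preS (lproj (addS V W)) N4 = addS (addS X V) W.
  by apply: lsub_ext => h; have := lproj_eq0 (addS (addS X V) W) h; rewrite -seqT4E.
have [||n||k4 [k4n h4E T4u]] := @exact_step _ _ (seqT4 X V W) N4
  (map (lproj _) c) (map (lproj _) d) _ _ _ _ g4 _ _ _ hom4 T3u gen4 _.
- exact: basis_lproj N4E (flag3 F).
- apply: basis_mod_im; first exact: lproj_onto.
  rewrite N4E; have := flag4 F; congr basis_mod.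
  exact: lsub_ext.
- by [].
- by rewrite -map_cat.
rewrite map_seqT4 in T4u.
exists (k1, k2, k3, k4); split; split=> //.
by apply: val_inj; rewrite /= E5 T4u (proj1 G5).
Qed.

(** By independence of the choices a linear map as required exists, and adapted
    bases give its value. *)
Lemma SPair_flag : SPair X V W (g3 ⊗ (g1 ⊗ dual_gen g4)) =
  (-1) ^+ ((size b + size c) * size a + size d * size c) *:
    (g2 ⊗ dual_gen g5).
Proof.
have d1E := dim_basis (flag_basis1 F).
have d3E := dim_basis (flag_basis3 F).
have d4E := dim_basis (flag_basis4 F).
have d5E := dim_basis (flag_basis5 F).
rewrite size_map in d1E; rewrite size_map size_cat size_map in d3E.
rewrite size_map size_cat in d4E; rewrite size_map in d5E.
set sg := _ ^+ _.
have [f fE] := generator_lin (sg *: (g2 ⊗ dual_gen g5))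
  (generator_tensor (proj2 G3) (generator_tensor (proj2 G1) (dual_generator (proj2 G4)))).
have -> : sg = (-1) ^+ (Defs.dim (lsub_of X) * Defs.dim (lsub_of (capS V W)) +
    Defs.dim (coker (addS X V) W) *
      (Defs.dim (coker V W) - Defs.dim (coker (addS X V) W)))%N.
  by rewrite d1E d3E d4E d5E addnK.
rewrite /SPair; set P := (X in get X).
apply: (getPex (P := P)) (flag_adapted F G1 G2 G3 G4 G5).
exists f => u1 u2 u3 u4 h1 h2 h3 h4 h5 /adapted_scalars[[[[k1 k2] k3] k4]].
move=> [[k1n k2n k3n k4n] [-> -> -> -> ->]].
by rewrite d1E d3E d4E d5E addnK -/sg; apply: rescaled_generators;
  [exact: (proj2 G4)|exact: (proj2 G5)|..].
Qed.

End Independence.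

(** * Associativity *)

Section FiniteDimension.
Variables (K : fieldType) (H : lmodType K).
Implicit Types (X Y V W N S : lsubspace H).

(** All vectors of N and S come from V, so equality of the traces on V is
    equality. *)
Lemma basis_unlift V N S (s : seq (lsub_of V)) :
    (forall h, N h -> V h) -> (forall h, S h -> V h) ->
    basis_mod (preS (@lsub_val K H V) N) (preS (@lsub_val K H V) S) s ->
  basis_mod N S (map (@lsub_val K H V) s).
Proof.
elim: s N => [N NV SV NS|x s IH N NV SV /= [Nx b]].
  apply: lsub_ext => h; have E : V h -> N h <-> S h.
    move=> Vh; rewrite -(lift_val Vh) -[N _]/(preS (@lsub_val K H V) N _) NS.
    by [].
  by split=> Nh; apply/E => //; [exact: NV|exact: SV].
split=> //; apply: IH => //; last by rewrite preS_adjS.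
move=> h [c /NV]; rewrite -{2}(subrK (c *: lsub_val x) h) => Vh.
by apply: subDS => //; apply: subZS; exact: lsub_valP.
Qed.

Lemma finite_dim_sub V : finite_dim (lsub_of V) -> exists s, basis_mod (zeroS H) V s.
Proof.
move=> /finite_dim_basis[s b]; exists (map (@lsub_val K H V) s).
apply: basis_unlift => //; first by move=> h ->; exact: sub0S.
by rewrite preS_val_zero preS_val_full.
Qed.

Lemma finite_dim_quot N : finite_dim (lquot N) -> exists s, basis_mod N (fullS H) s.
Proof.
move=> /finite_dim_basis[s b].
have /choice[r rE] : forall q : lquot N, exists h, lproj N h = q by exact: lproj_onto.
exists (map r s).
have := basis_mod_pre (f := lproj N) (N := zeroS _) (S := fullS _) (s := map r s).
rewrite -map_comp map_id_in; last by move=> q _; exact: rE.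
by rewrite preS_lproj_zero => /(_ b); congr basis_mod; apply: lsub_ext.
Qed.

Lemma addSC V W : addS V W = addS W V.
Proof.
by apply: lsub_ext => h; split=> -[v Vv [w Ww <-]]; exists w => //; exists v => //;
  rewrite addrC.
Qed.

Lemma addS0 V : addS V (zeroS H) = V.
Proof.
apply: lsub_ext => h; split=> [[v Vv [_ -> <-]]|Vh]; first by rewrite addr0.
exact: addS_subl.
Qed.

Lemma exists_flag X V W s a e : (forall h, X h -> V h -> h = 0) ->
    basis_mod (zeroS H) X s -> basis_mod (zeroS H) (capS V W) a ->
    basis_mod (addS V W) (fullS H) e ->
  exists p b c d, flag X V W p a b c d.
Proof.
move=> XV0 bX ba be.
have [t _] := exists_basis_add V bX.
rewrite addS0 addSC => /(exists_basis_cap W)[b bb].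
have [c cs] := exists_basis_add (addS V W) bX.
rewrite addS0 (addSC (addS V W)) addSA => bc.
have [d _] := exists_basis_add (addS (addS X V) W) be.
have -> : addS (addS (addS X V) W) (addS V W) = addS (addS X V) W.
  apply: lsub_ext => h; split=> [[u Su [_ [v Vv [w Ww <-]] <-]]|].
    by apply: subDS => //; exists v; [exact: addS_subr|exists w].
  exact: addS_subl.
have -> : addS (addS (addS X V) W) (fullS H) = fullS H.
  by apply: lsub_ext => h; split=> // _; exact: addS_subr.
move=> bd.
have /choice[p pE] : forall h, exists x, addS X V h -> X x /\ V (h - x).
  move=> h; have [[x Xx [v Vv <-]]|//] := pselect (addS X V h); last by exists 0.
  by exists x => _; rewrite addrC addKr.
exists p, b, c, d; split=> // h /cs; exact: basis_mod_in bX.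
Qed.

Lemma ext_pow_map (M P : lmodType K) (f : {linear M -> P}) k u :
  ext_pow M k u -> ext_pow P k (ext_map f u).
Proof.
move=> hu; apply: (spanS_ind (Q := preS (ext_map f) (ext_pow P k)) _ hu).
move=> _ [s /= sk <-]; rewrite /lsub_mem /= ext_mapE; apply: ext_pow_mon.
by rewrite size_map.
Qed.

Lemma basis_addS X Y s t : (forall h, X h -> Y h -> h = 0) ->
    basis_mod (zeroS H) X s -> basis_mod (zeroS H) Y t ->
  basis_mod (zeroS H) (addS X Y) (s ++ t).
Proof.
move=> XY0 bX bY; apply: basis_mod_cat bX _; apply: (basis_mod_add (W := Y)).
  by move=> h; exact: basis_mod_in bY.
suff -> : capS X Y = zeroS H by [].
apply: lsub_ext => h; split=> [[Xh Yh]|->]; first exact: XY0.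
exact: (sub0S (capS X Y)).
Qed.

Lemma SDet_mon X Y s t gX gY : (forall h, X h -> Y h -> h = 0) ->
    basis_mod (zeroS H) X s -> basis_mod (zeroS H) Y t ->
    lsub_val gX = ext_mon (map (lift X) s) ->
    lsub_val gY = ext_mon (map (lift Y) t) ->
  lsub_val (SDet X Y (gX ⊗ gY)) = ext_mon (map (lift (addS X Y)) (s ++ t)).
Proof.
move=> XY0 bX bY gXE gYE.
have dX := dim_basis (basis_lift_full bX); have dY := dim_basis (basis_lift_full bY).
have dXY := dim_basis (basis_lift_full (basis_addS XY0 bX bY)).
rewrite size_map in dX; rewrite size_map in dY; rewrite size_map size_cat in dXY.
pose w (xi : Det (lsub_of X)) (eta : Det (lsub_of Y)) :=
  ext_map (lincl X (addS X Y)) (lsub_val xi) ∧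
    ext_map (lincl Y (addS X Y)) (lsub_val eta).
pose D := ext_pow (lsub_of (addS X Y)) (Defs.dim (lsub_of (addS X Y))).
have wP xi eta : D (w xi eta).
  rewrite /D dXY -dX -dY; apply: ext_pow_wedge; apply: ext_pow_map; exact: det_pow.
have wlE (xi : Det (lsub_of X)) (eta : Det (lsub_of Y)) :
    lsub_val (lift D (w xi eta)) = w xi eta by exact: lift_val.
have [||f fE] := @tens_univ K _ _ _ (fun xi eta => lift D (w xi eta)).
- move=> eta c xi xi'; apply: val_inj.
  rewrite [LHS]wlE -[RHS]/(c *: lsub_val _ + lsub_val _) !wlE /w.
  by rewrite !linearP -/(wedger _ _) linearP.
- move=> xi c eta eta'; apply: val_inj.
  rewrite [LHS]wlE -[RHS]/(c *: lsub_val _ + lsub_val _) !wlE /w.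
  by rewrite !linearP.
have -> : lsub_val (SDet X Y (gX ⊗ gY)) = w gX gY.
  apply: (getPex (P := [set f : {linear tens (Det (lsub_of X)) (Det (lsub_of Y)) ->
                       Det (lsub_of (addS X Y))} |
    forall xi eta, lsub_val (f (xi ⊗ eta)) = w xi eta])).
  by exists f => xi eta; rewrite fE wlE.
rewrite /w gXE gYE !ext_mapE wedgeE map_cat -!map_comp; congr (ext_mon (_ ++ _)).
  apply/eq_in_map => h hs; apply/esym/liftE.
  by rewrite linclE ?lift_val//; [exact: basis_mod_in bX hs|move=> ?; exact: addS_subl].
apply/eq_in_map => h hs; apply/esym/liftE.
by rewrite linclE ?lift_val//; [exact: basis_mod_in bY hs|move=> ?; exact: addS_subr].
Qed.

End FiniteDimension.

Section Casts.
Variables (K : fieldType) (H : lmodType K) (W Z Z' : lsubspace H) (e : Z = Z').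

Lemma ecast_fun (A : Type) (f : A -> DetP Z W) x :
  ecast Z (A -> DetP Z W) e f x = ecast Z (DetP Z W) e (f x).
Proof. by case: _ / e. Qed.

Lemma ecastZ c (x : DetP Z W) :
  ecast Z (DetP Z W) e (c *: x) = c *: ecast Z (DetP Z W) e x.
Proof. by case: _ / e. Qed.

(** Generators given by vectors of H have the same form for Z and Z'. *)
Lemma ecast_tensor s t (g2 : Det (lsub_of (capS Z W))) (g5 : Det (coker Z W))
    (h2 : Det (lsub_of (capS Z' W))) (h5 : Det (coker Z' W)) :
    lsub_val g2 = ext_mon (map (lift (capS Z W)) s) ->
    lsub_val g5 = ext_mon (map (lproj (addS Z W)) t) ->
    lsub_val h2 = ext_mon (map (lift (capS Z' W)) s) ->
    lsub_val h5 = ext_mon (map (lproj (addS Z' W)) t) ->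
  ecast Z (DetP Z W) e (g2 ⊗ dual_gen g5) = h2 ⊗ dual_gen h5.
Proof.
case: _ / e h2 h5 => h2 h5 g2E g5E h2E h5E.
have -> : h2 = g2 by apply: val_inj; rewrite /= g2E.
by have -> : h5 = g5 by apply: val_inj; rewrite /= g5E.
Qed.

End Casts.

Section Associativity.
Variables (K : fieldType) (H : lmodType K) (X Y V W : lsubspace H).
Hypothesis XY0 : forall h, X h -> Y h -> h = 0.
Hypothesis XYV0 : forall h, addS X Y h -> V h -> h = 0.

Lemma disj_X_YV h : X h -> addS Y V h -> h = 0.
Proof.
move=> Xh [y Yy [v Vv e]]; suff v0 : v = 0.
  by apply: XY0 => //; rewrite -e v0 addr0.
apply: XYV0 => //; exists h => //; exists (- y); first exact: subNS.
by rewrite -e addrAC subrr add0r.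
Qed.

Lemma disj_Y_V h : Y h -> V h -> h = 0.
Proof. by move=> Yh; apply: XYV0; exact: addS_subr. Qed.

Variables (p q : H -> H) (a b2 b3 c2 c3 c4 : seq H).
Hypothesis FX : flag X (addS Y V) W p (a ++ b2) c2 c3 c4.
Hypothesis FY : flag Y V W q a b2 b3 (c3 ++ c4).

(* The component in X + Y of a vector of X + Y + V. *)
Let r h := p h + q (h - p h).

(** The filtration V ∩ W, (Y + V) ∩ W, (X + Y + V) ∩ W and that of H by V + W,
    Y + V + W, X + Y + V + W concatenate the bases of the two steps. *)
Lemma flag_sum : flag (addS X Y) V W r a (b2 ++ c2) (b3 ++ c3) c4.
Proof.
split=> //.
- move=> h; rewrite -(addSA X Y V) => /(flag_proj FX)[Xp YVp].
  have [Yq Vq] := flag_proj FY YVp; split; last by rewrite /r opprD addrA.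
  by exists (p h) => //; exists (q (h - p h)).
- exact: (flag1 FY).
- by rewrite -(addSA X Y V); exact: basis_mod_cat (flag2 FY) (flag2 FX).
- by rewrite -(addSA X Y V); exact: basis_mod_cat (flag3 FY) (flag3 FX).
- move=> h; rewrite mem_cat => /orP[/(flag_in FY) Yh|/(flag_in FX) Xh].
    exact: addS_subr.
  exact: addS_subl.
- by rewrite -(addSA X Y V); exact: (flag4 FX).
Qed.

Lemma flag_sum_b2 : map r b2 = map q b2.
Proof.
apply/eq_in_map => h /(flag_b_in FY)[YVh _].
suff p0 : p h = 0 by rewrite /r p0 add0r subr0.
have [Xp YVp] : X (p h) /\ addS Y V (h - p h).
  by apply: (flag_proj FX); exact: addS_subr.
apply: disj_X_YV => //; rewrite -(subKr h (p h)); exact: subBS.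
Qed.

(** The Y-components of r c2 are irrelevant next to a basis of Y; the rest is a
    permutation of blocks. *)
Lemma mon_sum :
  ext_mon (map (lift (addS X Y)) (map r (b2 ++ c2) ++ (b3 ++ c3))) =
  (-1) ^+ (size c2 * size b3 + (size b2 + size b3) * (size c2 + size c3)) *:
    ext_mon (map (lift (addS X Y)) ((map p c2 ++ c3) ++ (map q b2 ++ b3))).
Proof.
rewrite [map r _]map_cat flag_sum_b2 !map_cat -!catA.
set l := lift (addS X Y); set Lb := map l (map q b2); set Lp := map l (map p c2).
rewrite ext_mon_swap_cat !size_map.
pose N := preS (@lsub_val K H (addS X Y)) Y.
have bY : basis_mod (zeroS H) Y (map q b2 ++ b3).
  exact: basis_mod_cat (flag_basis_ker3 FY) (flag_basis_X3 FY).
have kN : kills (wedge (ext_mon (map l (map q b2 ++ b3)))) N.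
  apply: kills_wedge; have := basis_lift (V := addS X Y) _ bY.
  rewrite preS_val_zero; apply => h /(basis_mod_in bY); exact: addS_subr.
have Nc h : h \in c2 -> N ((l \o r) h - (l \o p) h).
  move=> /(flag_b_in FX)[hs _]; have [Xp YVp] := flag_proj FX hs.
  have [Yq Vq] := flag_proj FY YVp.
  rewrite -[N _]/(Y (lsub_val (l (r h)) - lsub_val (l (p h)))) !lift_val.
  - by rewrite /r addrC addKr.
  - exact: addS_subl.
  - by exists (p h) => //; exists (q (h - p h)).
have E : wedge (ext_mon (map l (map q b2 ++ b3)))
      (ext_mon (map (l \o r) c2 ++ map l c3)) =
    wedge (ext_mon (map l (map q b2 ++ b3)))
      (ext_mon (map (l \o p) c2 ++ map l c3)).
  exact: kills_congr [::] (map l c3) kN Nc.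
move: E; rewrite 2!wedgeE (map_comp l r) (map_comp l p) map_cat -!catA => ->.
rewrite -/Lb -/Lp catA -(cats0 (map l c3)) [Lp ++ _]catA.
have := ext_mon_swap_cat [::] (Lb ++ map l b3) (Lp ++ map l c3) [::].
rewrite !cats0 /= => ->.
by rewrite !size_cat !size_map scalerA -exprD -!catA.
Qed.

Lemma sign_sum n1 m2 m3 n2 n3 n4 :
  (-1) ^+ ((m2 + m3) * n1 + (n3 + n4) * m3) *
    (-1) ^+ ((n2 + n3) * (n1 + m2) + n4 * n3) =
  (-1) ^+ (n2 * m3 + (m2 + m3) * (n2 + n3)) *
    (-1) ^+ ((m2 + n2 + (m3 + n3)) * n1 + n4 * (m3 + n3)) :> K.
Proof.
(* The right-hand exponent exceeds the left-hand one by 2 * n2 * m3. *)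
rewrite -!exprD; set i := (_ + _)%N; set j := (_ + _)%N.
have -> : (j = i + 2 * (n2 * m3))%N by rewrite /i /j; ring.
by rewrite exprD exprM sqrrN expr1n expr1n mulr1.
Qed.

Lemma SPair_assoc_flag :
  ecast Z (tens (tens (Det (lsub_of X)) (Det (lsub_of Y))) (DetP V W) -> DetP Z W)
    (addSA X Y V)
    (SPair X (addS Y V) W
       \o tens_map idfun (SPair Y V W)
       \o tens_assoc (Det (lsub_of X)) (Det (lsub_of Y)) (DetP V W)) =
  SPair (addS X Y) V W \o tens_map (SDet X Y) idfun.
Proof.
have FS := flag_sum.
have [h1 D1] := basis_det (flag_basis1 FY).
have [m2 D2] := basis_det (flag_basis2 FY).
have [hY DY] := basis_det (flag_basis3 FY).
have [h4 D4] := basis_det (flag_basis4 FY).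
have [m5 D5] := basis_det (flag_basis5 FY).
have [r2 R2] := basis_det (flag_basis2 FX).
have [hX DX] := basis_det (flag_basis3 FX).
have [r5 R5] := basis_det (flag_basis5 FX).
have [z2 Z2] := basis_det (flag_basis2 FS).
have [z3 Z3] := basis_det (flag_basis3 FS).
have [z5 Z5] := basis_det (flag_basis5 FS).
have EY := SPair_flag FY D1 D2 DY D4 D5.
have EX := SPair_flag FX D2 R2 DX D5 R5.
have D4' : det_gen (ext_mon (map (lproj (addS V W)) ((b3 ++ c3) ++ c4))) h4.
  by rewrite -catA.
have ES := SPair_flag FS D1 Z2 Z3 D4' Z5.
have SE : SDet X Y (hX ⊗ hY) =
    (-1) ^+ (size c2 * size b3 + (size b2 + size b3) * (size c2 + size c3)) *: z3.
  apply: val_inj; rewrite /= (proj1 Z3) mon_sum scalerA -expr2 sqrr_sign scale1r.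
  apply: SDet_mon (proj1 DX) (proj1 DY) => //.
    exact: basis_mod_cat (flag_basis_ker3 FX) (flag_basis_X3 FX).
  exact: basis_mod_cat (flag_basis_ker3 FY) (flag_basis_X3 FY).
(* Both sides are linear, so one generator of the source line suffices. *)
apply/funext => t.
have [_ /(_ t)[k ->]] : generator ((hX ⊗ hY) ⊗ (h1 ⊗ dual_gen h4)).
  apply: generator_tensor; apply: generator_tensor.
  - exact: (proj2 DX).
  - exact: (proj2 DY).
  - exact: (proj2 D1).
  - exact: dual_generator (proj2 D4).
rewrite ecast_fun /= !linearZ /= ecastZ; congr (_ *: _).
rewrite tens_assocE !tens_mapE /= EY tensorZr linearZ /= EX scalerA ecastZ.
rewrite (@ecast_tensor _ _ _ _ _ _ ((a ++ b2) ++ c2) c4 _ _ z2 z5); first last.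
- exact: (proj1 Z5).
- by rewrite -catA; exact: (proj1 Z2).
- exact: (proj1 R5).
- exact: (proj1 R2).
rewrite SE tensorZl linearZ /= ES scalerA !size_cat; congr (_ *: _).
exact: sign_sum.
Qed.

End Associativity.

Theorem SPair_assoc (K : fieldType) (H : lmodType K) (X Y V W : lsubspace H) :
    finite_dim (lsub_of X) -> finite_dim (lsub_of Y) ->
    finite_dim (lsub_of (capS V W)) -> finite_dim (coker V W) ->
    X `&` Y = [set 0] -> addS X Y `&` V = [set 0] ->
  ecast Z (tens (tens (Det (lsub_of X)) (Det (lsub_of Y))) (DetP V W) -> DetP Z W)
    (addSA X Y V)
    (SPair X (addS Y V) W
       \o tens_map idfun (SPair Y V W)
       \o tens_assoc (Det (lsub_of X)) (Det (lsub_of Y)) (DetP V W)) =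
  SPair (addS X Y) V W \o tens_map (SDet X Y) idfun.
Proof.
move=> /finite_dim_sub[s bX] /finite_dim_sub[t bY] /finite_dim_sub[a ba].
move=> /finite_dim_quot[e be] XY XYV.
have XY0 h : X h -> Y h -> h = 0.
  by move=> Xh Yh; have : (X `&` Y) h by []; rewrite XY.
have XYV0 h : addS X Y h -> V h -> h = 0.
  by move=> Sh Vh; have : (addS X Y `&` V) h by []; rewrite XYV.
have [q [b2 [b3 [d FY]]]] := exists_flag (disj_Y_V XYV0) bY ba be.
have [p [c2 [c3 [c4 FX]]]] := exists_flag (disj_X_YV XY0 XYV0) bX
  (basis_mod_cat (flag1 FY) (flag2 FY)) (flag4 FY).
apply: (SPair_assoc_flag XY0 XYV0 FX (q := q) (b3 := b3)).
case: FY => *; split=> //; exact: basis_mod_cat (flag3 FX) (flag4 FX).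
Qed.

(* The two sides have values in DetP (X + (Y + V)) W and DetP ((X + Y) + V) W;
   the cast is along the associativity of the sum of subspaces. *)
Theorem mainTheorem10 (R : realType) (k : scalar_kind)
  (H : completeNormedModType (scalars R k))
  (ip : {dot H for @scalar_conj R k})
  (ip_norm : forall x : H, ip x x = `|x| ^+ 2)
  (H_separable : separable_space H)
  (H_infinite : ~ finite_dim H)
  (X Y V W : lsubspace H)
  (X_fin : finite_dim (lsub_of X))
  (Y_fin : finite_dim (lsub_of Y))
  (VW_fredholm : fredholm_pair V W)
  (XY0 : X `&` Y = [set 0])
  (XYV0 : addS X Y `&` V = [set 0]) :
  ecast Z (tens (tens (Det (lsub_of X)) (Det (lsub_of Y))) (DetP V W) -> DetP Z W)
    (addSA X Y V)
    (SPair X (addS Y V) W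
       \o tens_map idfun (SPair Y V W)
       \o tens_assoc (Det (lsub_of X)) (Det (lsub_of Y)) (DetP V W)) =
  SPair (addS X Y) V W \o tens_map (SDet X Y) idfun.
Proof.
by have [_ _ VW0 VW1] := VW_fredholm; exact: SPair_assoc.
Qed.
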